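(* Let $q \equiv 3 \pmod 4$ be a prime power and let $D \subset \mathbb{F}_{q^6}^*$ be the set defined in the context. Then the set $\mathcal{M} = \{\langle x\rangle : x \in D\}$ of points of $\mathsf{PG}(5,q)$ corresponding to $D$ is a $\frac{q+1}{2}$-ovoid of $\mathcal{Q}^-(5,q)$.
   Context: Let $q\equiv 3 \pmod 4$ be a prime power and $N = q^2+q+1$ (an odd integer). $\mathrm{Tr}_{q^n/q}(x)=x+x^q+\cdots+x^{q^{n-1}}$ is the trace from $\mathbb{F}_{q^n}$ to $\mathbb{F}_q$. Quadric and ovoids: view $\mathbb{F}_{q^6}$ as a 6-dimensional $\mathbb{F}_q$-vector space underlying $\mathsf{PG}(5,q)$; for $x\ne 0$, $\langle x\rangle$ denotes the projective point $\mathbb{F}_q x$. The elliptic quadric $\mathcal{Q}^-(5,q)$ is the generalized quadrangle of order $(q,q^2)$ of totally singular points and totally singular lines of the quadratic form $Q(x)=\mathrm{Tr}_{q^3/q}(x^{q^3+1})$ on $\mathbb{F}_{q^6}$. A set of points of $\mathcal{Q}^-(5,q)$ is an $m$-ovoid if every line of $\mathcal{Q}^-(5,q)$ meets it in exactly $m$ points. Definition of $D$: let $\omega$ be a primitive element of $\mathbb{F}_{q^3}$ and $\gamma$ a primitive element of $\mathbb{F}_{q^6}$ with $\gamma^{q^3+1}=\omega$. Let $I_{\mathcal Q}=\{i : 0\le i\le N-1,\ \mathrm{Tr}_{q^3/q}(\omega^{2i})=0\}=\{d_0,d_1,\dots,d_q\}$ (numbered in any order), let $S=\{i \bmod N : \mathrm{Tr}_{q^3/q}(\omega^i)=0\}\subset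 \mathbb{Z}_N$, and put $$\mathcal{X}=\{\omega^{d_i}\,\mathrm{Tr}_{q^3/q}(\omega^{d_0+d_i}) : 1\le i\le q\}\cup\{2\omega^{d_0}\},\qquad X=\{\log_\omega(x) \bmod 2N : x\in\mathcal{X}\}\subset\mathbb{Z}_{2N}.$$ Write $X = 2S_1''\cup(2S_2''+N) \pmod{2N}$ with $S_1'',S_2''\subseteq\mathbb{Z}_N$, $|S_1''|+|S_2''|=q+1$ (the partition of $X$ into its even and odd elements). For $i=1,2$ let $S_i'\equiv 2S_i''\pmod N$ and $S_i\equiv 2S_i' \pmod N$; then $S_1,S_2$ partition $S$. Let $J_1=\{0,3\}$, $J_2=\{1,2\}$, $$I=\{Ni-(q+1)j \bmod 4N : (i,j)\in (J_1\times S_1)\cup(J_2\times S_2)\},\qquad D=\bigcup_{i\in I}C_i^{(4N,q^6)},$$ where $C_i^{(4N,q^6)}=\gamma^i C_0$ and $C_0$ is the subgroup of index $4N$ of $\mathbb{F}_{q^6}^*$. ($I$ is well defined since $4\mid q+1$.) *)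

(* Defs.v *)
From HB Require Import structures.
From mathcomp Require Import all_boot all_order all_algebra.
From mathcomp Require Import all_fingroup all_solvable all_field.

Set Implicit Arguments.
Unset Strict Implicit.
Unset Printing Implicit Defensive.

Import GRing.Theory.
Local Open Scope ring_scope.

(* Over a finite field the set of subspaces is finite; this gives access to
   [{set {vspace V}}] and to cardinalities of families of subspaces. *)
Import VectorInternalTheory. (* subtype structure of {vspace V} *)
HB.instance Definition _ (F : finFieldType) (V : vectType F) :=
  [Countable of {vspace V} by <:].
HB.instance Definition _ (F : finFieldType) (V : vectType F) :=
  [Finite of {vspace V} by <:].

(* Tr_{q^n/q}, computed inside an ambient field. *)
Definition trace (R : nzRingType) (q n : nat) (x : R) : R :=
  \sum_(i < n) x ^+ (q ^ i).

Definition quadric_form (R : nzRingType) (q : nat) (x : R) : R :=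
  trace q 3 (x ^+ (q ^ 3 + 1)).

Section Geometry.
Variables (F : finFieldType) (L : fieldExtType F) (q : nat).

Definition totally_singular (U : {vspace finvect_type L}) : bool :=
  [forall x : finvect_type L, (x \in U) ==> (quadric_form q x == 0)].

(* Points and lines of PG(V) are the subspaces of V of vector-space dimension
   1 and 2; incidence is inclusion. *)
Definition quadric_points : {set {vspace finvect_type L}} :=
  [set P | (\dim P == 1)%N && totally_singular P].

Definition quadric_lines : {set {vspace finvect_type L}} :=
  [set l | (\dim l == 2)%N && totally_singular l].

Definition is_m_ovoid (m : nat) (M : {set {vspace finvect_type L}}) : Prop :=
  M \subset quadric_points /\
  (forall l, l \in quadric_lines -> #|[set P in M | (P <= l)%VS]| = m).

End Geometry.

Definition NN (q : nat) : nat := (q ^ 2 + q + 1)%N.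

Section Construction.
Variables (F : finFieldType) (L : fieldExtType F) (q : nat).
Local Notation K := (finvect_type L).
Local Notation N := (NN q).
Variables (w g : K) (d : 'I_q.+1 -> 'I_N).

Definition I_Q : {set 'I_N} := [set i : 'I_N | trace q 3 (w ^+ (2 * i)) == 0].

Definition calX : {set K} :=
  [set w ^+ d i * trace q 3 (w ^+ (d ord0 + d i)) | i : 'I_q.+1 & i != ord0]
    :|: [set 2%:R * w ^+ d ord0].

(* For w of order q^3 - 1, log_w x is the unique j < q^3 - 1 with w^j = x. *)
Definition logX : {set 'Z_(2 * N)} :=
  [set j%:R | j : 'I_(q ^ 3 - 1) & w ^+ j \in calX].

(* logX is the union of 2 S1'' (its even part) and 2 S2'' + N (its odd part,
   N being odd); these two conditions determine S1'' and S2''. *)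
Definition S1'' : {set 'Z_N} := [set s : 'Z_N | (2 * s)%N%:R \in logX].
Definition S2'' : {set 'Z_N} := [set s : 'Z_N | (2 * s + N)%N%:R \in logX].

Definition double (A : {set 'Z_N}) : {set 'Z_N} := [set 2%:R * s | s in A].

Definition S1 : {set 'Z_N} := double (double S1'').
Definition S2 : {set 'Z_N} := double (double S2'').

(* J x S |-> { N i - (q + 1) j mod 4N }.  The class modulo 4N does not depend
   on the representative of j modulo N, since 4 divides q + 1. *)
Definition exponents (J : seq nat) (S : {set 'Z_N}) : {set 'Z_(4 * N)} :=
  [set e | [exists j in S,
     has (fun i => e == (N * i)%N%:R - ((q + 1) * j)%N%:R) J]].

Definition I_D : {set 'Z_(4 * N)} :=
  exponents [:: 0; 3]%N S1 :|: exponents [:: 1; 2]%N S2.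

(* C0 is meant to be the subgroup of index 4 N of the multiplicative group. *)
Definition cyclotomic_class (C0 : {set {unit K}}) (i : nat) : {set K} :=
  [set g ^+ i * FinRing.uval u | u in C0].

Definition D_set (C0 : {set {unit K}}) : {set K} :=
  \bigcup_(i in I_D) cyclotomic_class C0 i.

Definition point_set (D : {set K}) : {set {vspace K}} :=
  [set <[x]>%VS | x : K in D].

End Construction.

(* Main.v *)
Require Import Defs.
From mathcomp Require Import all_boot all_order all_algebra.
From mathcomp Require Import all_fingroup all_solvable all_field.
From mathcomp Require Import zify ring.

Set Implicit Arguments.
Unset Strict Implicit.
Unset Printing Implicit Defensive.

Import GRing.Theory.
Local Open Scope ring_scope.

(** The signed indicator h of D, equal to 1 on D and to -1 off D, sums to zero
    over the nonzero vectors of every totally singular line l.  Since D is a union of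
    punctured points and a line has q + 1 points, this says that half of
    them belong to the point set.  The vanishing is obtained for all lines at once:
    the sum over the lines l of (sum of h over l)^2 is shown to be 0.

    Expanding the squares turns that into a statement about pairs of singular vectors.
    A nonzero singular vector lies on q^2 + 1 lines, two independent ones on
    exactly one line if they are orthogonal and on none otherwise, so everything
    reduces to the value of the correlation
      T = sum of h(x) h(y) over the orthogonal pairs of singular vectors x, y
    ([line_sum0], [half_ovoid]).

    Write E = F_{q^3}, bar x = x^(q^3), n(x) = x * bar x, Tr for the trace from E
    to F_q, eta for the quadratic character of E.  The vector x is singular if and
    only if n(x) is proportional to z^2 for a point z of the conic Tr(z^2) = 0 of E,
    and then x = z u with n(u) in F_q.  In these coordinates the definition
    of D becomes a product: h(z u) = f(z) sigma(u), where f(z) = eta(z Tr(z0 z))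
    (and eta(2 z0) at the base point z0), while sigma(u) = 1 or -1
    depends on the quartic residue class of u only ([mem_D_quadric_vec]).

    In T, averaging over multiplication of both vectors by a fixed t with n(t) = -1 replaces
    sigma(u) sigma(v) by the real part of the quartic character of u * bar v.
    The inner sum then runs over norm-one elements v with Tr(a (v + 1/v)) = 0, and
    v + 1/v = b transforms it into the sum of eta over the affine plane
    Tr(a x) = 2 Tr(a) of E, with a = z z' ([sum_quart_re_U1]).  That plane sum is
    0 if Tr(a) = 0, and otherwise it is eta(2 a Tr(a)) times a constant, which is the
    sum of eta over Tr(x) = 1, and equals -q because the quadric
    Tr(y^2) = 1 of E has q^2 - q points ([sum_quad_plane], [plane_sumE]).

    What is left is the sign f(z) f(z') eta(2 z z' Tr(z z')), and it is 1 for any two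
    distinct points of the conic: for three points it is eta of
    2 Tr(z0 z) Tr(z z') Tr(z0 z'), which is the Gram determinant of z0, z, z' and
    hence a square in E, namely that of the determinant of their conjugates
    ([gram_det], [conic_sign_pair]).  So T = -q^2 (q - 1) times the number of
    nonzero singular vectors, which is exactly what makes the sum of squares vanish. *)

(** * Arithmetic of the exponents *)

Lemma mulr_eq_self (R : idomainType) (x y : R) : x != 0 -> (x * y == x) = (y == 1).
Proof. by move=> x0; rewrite -{2}[x]mulr1 (inj_eq (mulfI x0)). Qed.

Lemma eqn_modMl c m n N : coprime c N ->
  (c * m == c * n %[mod N])%N = (m == n %[mod N])%N.
Proof.
move=> co; wlog le : m n / (n <= m)%N => [wl|].
  by case: (leqP n m) => [|/ltnW] le; [|rewrite eq_sym [RHS]eq_sym]; exact: wl.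
by rewrite !eqn_mod_dvd ?leq_mul2l ?le ?orbT // -mulnBr Gauss_dvdr // coprime_sym.
Qed.

Section Exponents.
Variable q : nat.
Hypothesis q_mod4 : (q = 3 %[mod 4])%N.

(** Half the order of the unit group of F_{q^3}, a quarter of the order of the group
    of norm-one elements of F_{q^6}, and half the order of the unit group of F_q.
    The first and the third are odd, so that -1 is a nonsquare of F_{q^3} and of F_q. *)
Definition halfE := ((q ^ 3 - 1) %/ 2)%N.
Definition quarterU := ((q ^ 3 + 1) %/ 4)%N.
Definition halfF := ((q - 1) %/ 2)%N.

Lemma q_decomp : exists k, q = (4 * k + 3)%N.
Proof. by exists (q %/ 4)%N; lia. Qed.

Lemma q_gt2 : (2 < q)%N. Proof. lia. Qed.

Lemma q3_halfE : (q ^ 3 = 2 * halfE + 1)%N.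
Proof.
rewrite /halfE; have [k ->] := q_decomp.
have -> : ((4 * k + 3) ^ 3 = 2 * (32 * k ^ 3 + 72 * k ^ 2 + 54 * k + 13) + 1)%N by ring.
lia.
Qed.

Lemma q3_quarterU : (q ^ 3 + 1 = 4 * quarterU)%N.
Proof.
rewrite /quarterU; have [k ->] := q_decomp.
have -> : ((4 * k + 3) ^ 3 + 1 = 4 * (16 * k ^ 3 + 36 * k ^ 2 + 27 * k + 7))%N by ring.
lia.
Qed.

Lemma q_halfF : (q = 2 * halfF + 1)%N.
Proof. by rewrite /halfF; lia. Qed.

Lemma halfE_norm : halfE = (halfF * NN q)%N.
Proof.
move: q3_halfE; rewrite /NN; move: halfE halfF q_halfF => e h ->.
have -> : ((2 * h + 1) ^ 3 =
  2 * (h * ((2 * h + 1) ^ 2 + (2 * h + 1) + 1)) + 1)%N by ring.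
by move: (h * _)%N => x; lia.
Qed.

Lemma odd_q : odd q. Proof. by have := q_mod4; lia. Qed.

Lemma odd_halfF : odd halfF.
Proof. by have := q_mod4; rewrite /halfF; lia. Qed.

Lemma odd_NN : odd (NN q).
Proof. by rewrite /NN !oddD oddX odd_q. Qed.

Lemma odd_halfE : odd halfE.
Proof. by rewrite halfE_norm oddM odd_halfF odd_NN. Qed.

Lemma q6_decomp : (q ^ 6 - 1 = (q ^ 3 - 1) * (q ^ 3 + 1))%N.
Proof.
have -> : (q ^ 6 = q ^ 3 * q ^ 3)%N by ring.
by rewrite mulnn -[X in (_ - X)%N](exp1n 2) subn_sqr.
Qed.

Lemma q6_quarter : (q ^ 6 - 1 = 4 * (2 * (halfE * quarterU)))%N.
Proof. by rewrite q6_decomp q3_quarterU q3_halfE addnK; ring. Qed.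

Lemma q3_norm : (q ^ 3 - 1 = (q - 1) * NN q)%N.
Proof. by rewrite q3_halfE halfE_norm addnK {2}q_halfF addnK mulnA. Qed.

End Exponents.

(** * Fixed fields of Frobenius powers and traces *)

Section Frobenius.
Variables (K : finFieldType) (q : nat).
Hypothesis q_mod4 : (q = 3 %[mod 4])%N.
Hypothesis frobD : forall x y : K, (x + y) ^+ q = x ^+ q + y ^+ q.

Lemma frobnD n (x y : K) : (x + y) ^+ (q ^ n) = x ^+ (q ^ n) + y ^+ (q ^ n).
Proof. by elim: n => [|n IHn]; rewrite ?expn0 ?expr1 // expnSr !exprM IHn frobD. Qed.

Lemma frobnN n (x : K) : (- x) ^+ (q ^ n) = - x ^+ (q ^ n).
Proof. by rewrite exprNn -signr_odd oddX (odd_q q_mod4) orbT mulN1r. Qed.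

Lemma frobnB n (x y : K) : (x - y) ^+ (q ^ n) = x ^+ (q ^ n) - y ^+ (q ^ n).
Proof. by rewrite frobnD frobnN. Qed.

Lemma expqn_gt0 n : (0 < q ^ n)%N.
Proof. by rewrite expn_gt0 (ltn_trans _ (q_gt2 q_mod4)). Qed.

Lemma frobn0 n : 0 ^+ (q ^ n) = 0 :> K.
Proof. by rewrite expr0n eqn0Ngt expqn_gt0. Qed.

(** The subfield F_{q^n} inside K, when n divides the degree of K over F_q. *)
Definition fixF n : {set K} := [set x | x ^+ (q ^ n) == x].

Lemma fixFP n x : reflect (x ^+ (q ^ n) = x) (x \in fixF n).
Proof. by rewrite inE; apply: eqP. Qed.

Lemma fixF0 n : 0 \in fixF n. Proof. by apply/fixFP/frobn0. Qed.
Lemma fixF1 n : 1 \in fixF n. Proof. by apply/fixFP/expr1n. Qed.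
Lemma fixFD n x y : x \in fixF n -> y \in fixF n -> x + y \in fixF n.
Proof. by move=> /fixFP hx /fixFP hy; apply/fixFP; rewrite frobnD hx hy. Qed.
Lemma fixFN n x : (- x \in fixF n) = (x \in fixF n).
Proof. by rewrite !inE frobnN eqr_opp. Qed.
Lemma fixFB n x y : x \in fixF n -> y \in fixF n -> x - y \in fixF n.
Proof. by move=> hx hy; rewrite fixFD ?fixFN. Qed.
Lemma fixFM n x y : x \in fixF n -> y \in fixF n -> x * y \in fixF n.
Proof. by move=> /fixFP hx /fixFP hy; apply/fixFP; rewrite exprMn hx hy. Qed.
Lemma fixFV n x : (x^-1 \in fixF n) = (x \in fixF n).
Proof. by rewrite !inE exprVn (inj_eq invr_inj). Qed.
Lemma fixF_div n x y : x \in fixF n -> y \in fixF n -> x / y \in fixF n.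
Proof. by move=> hx hy; rewrite fixFM ?fixFV. Qed.
Lemma fixFX n x m : x \in fixF n -> x ^+ m \in fixF n.
Proof. by move=> /fixFP hx; apply/fixFP; rewrite exprAC hx. Qed.
Lemma fixF_nat n m : m%:R \in fixF n.
Proof. by elim: m => [|m IHm]; rewrite ?fixF0 // -addn1 natrD fixFD ?fixF1. Qed.

Lemma fixF1_sub n x : x \in fixF 1 -> x \in fixF n.
Proof.
move/fixFP=> hx; apply/fixFP; elim: n => [|n IHn]; first by rewrite expr1.
by rewrite expnSr exprM IHn; move: hx; rewrite expn1.
Qed.

Lemma traceD n (x y : K) : trace q n (x + y) = trace q n x + trace q n y.
Proof. by rewrite /trace -big_split; apply: eq_bigr => i _; rewrite frobnD. Qed.

Lemma traceN n (x : K) : trace q n (- x) = - trace q n x.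
Proof. by rewrite /trace -sumrN; apply: eq_bigr => i _; rewrite frobnN. Qed.

Lemma trace0 n : trace q n (0 : K) = 0.
Proof. by rewrite /trace big1 // => i _; rewrite frobn0. Qed.

Lemma traceZ n (c x : K) : c \in fixF 1 -> trace q n (c * x) = c * trace q n x.
Proof.
move=> hc; rewrite /trace mulr_sumr; apply: eq_bigr => i _.
by rewrite exprMn (fixFP _ _ (fixF1_sub i hc)).
Qed.

Lemma trace_frob n m (x : K) : (trace q n x) ^+ (q ^ m) = trace q n (x ^+ (q ^ m)).
Proof.
rewrite /trace (big_morph (fun y => y ^+ (q ^ m)) (@frobnD m) (frobn0 m)).
by apply: eq_bigr => i _; rewrite exprAC.
Qed.

Lemma trace_frob1 n (x : K) : x \in fixF n -> trace q n (x ^+ q) = trace q n x.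
Proof.
case: n => [|n] hx; first by rewrite /trace !big_ord0.
rewrite /trace big_ord_recr big_ord_recl /= addrC expn0 expr1; congr (_ + _).
  by rewrite -exprM -expnS; apply/fixFP.
by apply: eq_bigr => i _; rewrite -exprM -expnS.
Qed.

Lemma trace_frobn n m (x : K) : x \in fixF n ->
  trace q n (x ^+ (q ^ m)) = trace q n x.
Proof.
elim: m => [|m IHm] hx; first by rewrite expr1.
by rewrite expnSr exprM trace_frob1 ?fixFX // IHm.
Qed.

Lemma trace_fixF1 n (x : K) : x \in fixF n -> trace q n x \in fixF 1.
Proof. by move=> hx; apply/fixFP; rewrite trace_frob trace_frobn. Qed.

Lemma trace3E (x : K) : trace q 3 x = x + x ^+ q + x ^+ (q ^ 2).
Proof. by rewrite /trace !big_ord_recr big_ord0 /= add0r expn0 expr1 expn1. Qed.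

Lemma trace6E (x : K) : trace q 6 x = trace q 3 (x + x ^+ (q ^ 3)).
Proof.
rewrite traceD !trace3E /trace !big_ord_recr big_ord0 /= add0r expn0 expr1 expn1.
by rewrite -!exprM -!expnSr -expnD !addrA.
Qed.

(* sliding *)
(** Along a translate of the line F_q x0, phi is an affine function of the parameter
    with nonzero slope, so that every value c in F_q is taken exactly once on it.  With phi a trace this counts hyperplanes; with phi
    quadratic and x0 isotropic it counts points of quadrics. *)
Lemma card_slide (A : {set K}) (x0 c : K) (phi s : K -> K) :
  {in A, forall x, phi x \in fixF 1} ->
  {in A, forall x, s x \in fixF 1 /\ s x != 0} ->
  {in A & fixF 1, forall x t, x + t * x0 \in A
     /\ phi (x + t * x0) = phi x + t * s x} ->
  c \in fixF 1 ->
  (#|fixF 1| * #|[set x in A | phi x == c]| = #|A|)%N.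
Proof.
move=> hphi hs hA hc.
pose S := \sum_(t in fixF 1) \sum_(x in A) (phi (x + t * x0) == c : nat).
have -> : #|A| = S.
  rewrite /S exchange_big /= -sum1_card; apply: eq_bigr => x xA.
  have [s1 s0] := hs _ xA.
  have t0F : (c - phi x) / s x \in fixF 1 by rewrite fixF_div ?fixFB // hphi.
  rewrite (bigD1 _ t0F) /= (hA _ _ xA t0F).2 divfK // [phi x + _]addrC subrK eqxx.
  rewrite big1 // => t /andP[tF nt]; rewrite (hA _ _ xA tF).2.
  apply/eqP; rewrite eqb0; apply: contra nt => /eqP <-.
  by rewrite addrC addKr mulfK.
rewrite /S -sum_nat_const; apply: eq_bigr => t tF.
have ntF : - t \in fixF 1 by rewrite fixFN.
rewrite -big_mkcondr /= sum1dep_card -[RHS](card_imset _ (addIr (t * x0))).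
apply: eq_card => x; rewrite !inE; apply/andP/imsetP => [[xA px]|[y]].
  exists (x - t * x0); last by rewrite subrK.
  by rewrite !inE -mulNr (hA _ _ xA ntF).1 mulNr subrK.
by rewrite !inE => /andP[yA py] ->; rewrite (hA _ _ yA tF).1.
Qed.

End Frobenius.
Arguments fixF K q n : clear implicits.

(** * Quadratic and quartic characters *)

Section Characters.
Variables (K : finFieldType) (q : nat) (g : K).
Hypothesis q_mod4 : (q = 3 %[mod 4])%N.
Hypothesis frobD : forall x y : K, (x + y) ^+ q = x ^+ q + y ^+ q.
Hypothesis card_K : #|K| = (q ^ 6)%N.
Hypothesis prim_g : (q ^ 6 - 1)%N.-primitive_root g.

Local Notation E := (fixF K q 3).
Local Notation Fq := (fixF K q 1).
Local Notation bar x := (x ^+ (q ^ 3)).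
Local Notation nm x := (x ^+ (q ^ 3 + 1)).

Lemma unit_expr (x : K) : x != 0 -> x ^+ (q ^ 6 - 1) = 1.
Proof.
move=> x0; apply: (mulIf x0); rewrite mul1r -exprSr subn1 -card_K.
by rewrite prednK ?expf_card // card_K expqn_gt0.
Qed.

Lemma gen_powP (x : K) : x != 0 -> exists e, x = g ^+ e.
Proof. by move/unit_expr/(prim_rootP prim_g) => [i ->]; exists i. Qed.

Lemma gen_neq0 : g != 0.
Proof.
apply/eqP => g0; have /eqP := prim_expr_order prim_g.
by rewrite g0 expr0n eqn0Ngt (prim_order_gt0 prim_g) eq_sym oner_eq0.
Qed.

(** The unit group is cyclic, so it has exactly m solutions of x^m = 1 for each
    divisor m of its order. *)
Lemma card_unity m : (m %| q ^ 6 - 1)%N -> #|[set x : K | x ^+ m == 1]| = m.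
Proof.
move=> dm; have prim_z := dvdn_prim_root prim_g dm; set z := g ^+ _ in prim_z.
rewrite -[RHS](card_ord m) -(card_imset _ (_ : injective (fun i : 'I_m => z ^+ i))).
  apply: eq_card => x; rewrite !inE; apply/eqP/imsetP => [xm|[i _ ->]].
    by have [i ->] := prim_rootP prim_z xm; exists i.
  by rewrite exprAC (prim_expr_order prim_z) expr1n.
move=> i j /eqP; rewrite (eq_prim_root_expr prim_z) !modn_small //.
by move/eqP/val_inj.
Qed.

Lemma card_fixF n : (q ^ n - 1 %| q ^ 6 - 1)%N -> #|fixF K q n| = (q ^ n)%N.
Proof.
move=> dn; have qn0 := expqn_gt0 q_mod4 n.
have qnS : (q ^ n = (q ^ n - 1).+1)%N by rewrite subn1 prednK.
rewrite (cardsD1 0) fixF0 // [in RHS]qnS add1n; congr S.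
have [n0|n0] := posnP (q ^ n - 1).
  rewrite n0 in dn; move: dn; rewrite dvd0n => /eqP E0.
  by move: (prim_order_gt0 prim_g); rewrite E0.
rewrite -(card_unity dn); apply: eq_card => x; rewrite !inE.
have [->|x0] /= := eqVneq x 0; first by rewrite expr0n eqn0Ngt n0 eq_sym oner_eq0.
have -> : x ^+ (q ^ n) = x * x ^+ (q ^ n - 1) by rewrite -exprS -qnS.
by rewrite mulr_eq_self.
Qed.

Lemma card_E : #|E| = (q ^ 3)%N.
Proof. by apply: card_fixF; rewrite q6_decomp dvdn_mulr. Qed.

Lemma card_Fq : #|Fq| = q.
Proof. by rewrite card_fixF ?expn1 // q6_decomp (q3_norm q_mod4) -mulnA dvdn_mulr. Qed.

Lemma opp1_neq1 : (-1 : K) != 1.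
Proof.
apply/eqP => E1; have d2 : (2 %| q ^ 6 - 1)%N.
  by rewrite (q6_quarter q_mod4) mulnCA dvdn_mulr.
have := card_unity d2; rewrite (_ : [set _ | _] = [set 1]) ?cards1 //.
by apply/setP=> x; rewrite !inE sqrf_eq1 E1 orbb.
Qed.

Lemma two_neq0 : (2%:R : K) != 0.
Proof. by apply: contra opp1_neq1; rewrite mulr2n addr_eq0 eq_sym. Qed.

(** The quartic character of K, with values in the fourth roots of unity of K. *)
Definition quart (x : K) : K := x ^+ (2 * (halfE q * quarterU q)).

Lemma quartM x y : quart (x * y) = quart x * quart y.
Proof. exact: exprMn. Qed.
Lemma quartV x : quart x^-1 = (quart x)^-1.
Proof. exact: exprVn. Qed.
Lemma quart1 : quart 1 = 1. Proof. exact: expr1n. Qed.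
Lemma quartX x n : quart (x ^+ n) = quart x ^+ n.
Proof. exact: exprAC. Qed.

Lemma quart4 x : x != 0 -> quart x ^+ 4 = 1.
Proof. by move=> x0; rewrite -exprM mulnC -q6_quarter ?unit_expr. Qed.

(** The product of x and bar x is a norm, and norms are fourth powers as 4 divides
    q^3 + 1. *)
Lemma quart_bar x : x != 0 -> quart (bar x) = (quart x)^-1.
Proof.
move=> x0; apply: (mulIf (x := quart x)); first by rewrite expf_neq0.
rewrite mulVf ?expf_neq0 // quartX -exprSr -addn1 (q3_quarterU q_mod4).
by rewrite exprM quart4 ?expr1n.
Qed.

Lemma E_expr x : x \in E -> x != 0 -> x ^+ (2 * halfE q) = 1.
Proof.
move=> /fixFP xE x0; apply: (mulIf x0).
by rewrite mul1r -exprSr -addn1 -(q3_halfE q_mod4).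
Qed.

Lemma quart_E x : x \in E -> x != 0 -> quart x = 1.
Proof. by move=> xE x0; rewrite /quart mulnA exprM E_expr ?expr1n. Qed.

Definition imag : K := quart g.

Lemma imag_sqr : imag ^+ 2 = -1.
Proof.
have i4 : imag ^+ 4 = 1 by rewrite quart4 ?gen_neq0.
have /eqP := i4; rewrite -[4%N]/(2 * 2)%N exprM sqrf_eq1 => /orP[/eqP i2|/eqP //].
have := dvdn_leq _ (_ : q ^ 6 - 1 %| 2 * (halfE q * quarterU q) * 2)%N.
rewrite (prim_order_dvd prim_g) exprM -[g ^+ _]/imag i2 eqxx => /(_ _ isT).
have := prim_order_gt0 prim_g; rewrite (q6_quarter q_mod4); lia.
Qed.

Lemma imag_neq0 : imag != 0.
Proof. by rewrite expf_neq0 ?gen_neq0. Qed.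

Lemma quart_cases x : x != 0 ->
  [\/ quart x = 1, quart x = imag, quart x = -1 | quart x = - imag].
Proof.
move=> x0; have := quart4 x0; rewrite -[4%N]/(2 * 2)%N exprM => /eqP.
rewrite sqrf_eq1 sqrf_eq1 -imag_sqr eqf_sqr.
by case/orP => /orP[] /eqP ->; rewrite ?imag_sqr; do ?[by constructor].
Qed.

(* Quadratic character of E *)
(** The quadratic character of the subfield E, with integer values so that it can
    be summed.  It is meaningful on E only. *)
Definition quad (x : K) : int := if x == 0 then 0 else if x ^+ halfE q == 1 then 1 else -1.

Lemma quad0 : quad 0 = 0. Proof. by rewrite /quad eqxx. Qed.

Lemma quad_sign x : x \in E -> x != 0 ->
  x ^+ halfE q = 1 /\ quad x = 1 \/ x ^+ halfE q = -1 /\ quad x = -1.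
Proof.
move=> xE x0; rewrite /quad (negbTE x0); have /eqP := E_expr xE x0.
rewrite mulnC exprM sqrf_eq1 => /orP[] /eqP ->; first by rewrite eqxx; left.
by rewrite (negbTE opp1_neq1); right.
Qed.

Lemma quadM x y : x \in E -> y \in E -> quad (x * y) = quad x * quad y.
Proof.
move=> xE yE; have [->|x0] := eqVneq x 0; first by rewrite mul0r quad0 mul0r.
have [->|y0] := eqVneq y 0; first by rewrite mulr0 quad0 mulr0.
rewrite {1}/quad mulf_eq0 (negbTE x0) (negbTE y0) exprMn /=.
case: (quad_sign xE x0) => [[-> ->]|[-> ->]];
  case: (quad_sign yE y0) => [[-> ->]|[-> ->]];
  by rewrite ?mulrNN ?mul1r ?mulr1 ?eqxx ?(negbTE opp1_neq1).
Qed.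

Lemma quadNK x : x \in E -> quad (- x) = - quad x.
Proof.
move=> xE; rewrite -mulN1r quadM ?fixFN ?fixF1 //.
have -> : quad (-1) = -1; last by rewrite mulN1r.
rewrite /quad oppr_eq0 oner_eq0 -signr_odd (odd_halfE q_mod4) expr1.
by rewrite (negbTE opp1_neq1).
Qed.

Lemma quad_sqr x : x \in E -> x != 0 -> quad x * quad x = 1.
Proof. by move=> xE x0; case: (quad_sign xE x0) => [[_ ->]|[_ ->]]. Qed.

Lemma quad_square x : x \in E -> x != 0 -> quad (x ^+ 2) = 1.
Proof. by move=> xE x0; rewrite expr2 quadM ?quad_sqr. Qed.

(** An odd power of x has the quadratic character of x. *)
Lemma quad_frob x n : x \in E -> quad (x ^+ (q ^ n)) = quad x.
Proof.
move=> xE; have [->|x0] := eqVneq x 0; first by rewrite frobn0.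
have -> : (q ^ n = (q ^ n)./2.*2 + 1)%N.
  by rewrite -[LHS]odd_double_half oddX (odd_q q_mod4) orbT addnC.
rewrite addn1 exprS -mul2n exprM exprAC.
by rewrite quadM ?fixFX // quad_square ?fixFX ?expf_neq0 // mulr1.
Qed.

(** The real part of the complex quartic character. *)
Definition quart_re (x : K) : int := if quart x == 1 then 1 else if quart x == -1 then -1 else 0.

Lemma barK (x : K) : bar (bar x) = x.
Proof. by rewrite -exprM -expnD -card_K expf_card. Qed.

Lemma nm_bar (x : K) : nm x = x * bar x.
Proof. by rewrite addn1 exprS. Qed.

Lemma nm_E (x : K) : nm x \in E.
Proof. by apply/fixFP; rewrite nm_bar exprMn barK mulrC. Qed.

Lemma quart_sqr x : quart x ^+ 2 = nm x ^+ halfE q.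
Proof. by rewrite -!exprM (q3_quarterU q_mod4); congr (_ ^+ _); ring. Qed.

(** Both sides are the value at t of the quadratic character of K: the ratio
    t / bar t has quartic character quart(t)^2. *)
Lemma quart_re_ratio t : t != 0 -> quart_re (t / bar t) = quad (nm t).
Proof.
move=> t0; rewrite /quart_re quartM quartV quart_bar // invrK -expr2 quart_sqr.
have n0 : nm t != 0 by rewrite expf_neq0.
case: (quad_sign (nm_E t) n0) => [[-> ->]|[-> ->]]; rewrite ?eqxx //.
by rewrite (negbTE opp1_neq1).
Qed.

Lemma quartN x : quart (- x) = quart x.
Proof. by rewrite /quart !exprM sqrrN. Qed.

Lemma quart_reN x : quart_re (- x) = quart_re x.
Proof. by rewrite /quart_re quartN. Qed.

(** The norm-one group of K over E. *)
Definition U1 : {set K} := [set v | nm v == 1].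

Lemma U1_neq0 v : v \in U1 -> v != 0.
Proof.
by rewrite inE; apply: contraTneq => ->; rewrite expr0n addn1 eq_sym oner_eq0.
Qed.

Lemma U1_bar v : v \in U1 -> bar v = v^-1.
Proof.
move=> vU; apply: (mulfI (U1_neq0 vU)); rewrite -nm_bar divff ?U1_neq0 //.
by move: vU; rewrite inE => /eqP.
Qed.

(** Hilbert 90 made explicit: v is t / bar t for t = v + 1, and - v is t / bar t for
    t = v - 1; the norms of these t are 2 + (v + 1/v) and 2 - (v + 1/v). *)
Lemma quart_re_U1 v : v \in U1 -> v ^+ 2 != 1 ->
  quart_re v = quad (2%:R + (v + v^-1)) /\ quart_re v = quad (2%:R - (v + v^-1)).
Proof.
move=> vU; have v0 := U1_neq0 vU; rewrite sqrf_eq1 negb_or => /andP[v1 vm1].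
split.
  have t0 : v + 1 != 0 by rewrite addr_eq0.
  have bt : bar (v + 1) = (v + 1) / v by rewrite frobnD // U1_bar // expr1n; field.
  have -> : 2%:R + (v + v^-1) = nm (v + 1) by rewrite nm_bar bt; field.
  by rewrite -quart_re_ratio // bt; congr (quart_re _); field; rewrite ?t0 ?v0.
have t0 : v - 1 != 0 by rewrite subr_eq0.
have bt : bar (v - 1) = - ((v - 1) / v) by rewrite frobnB // U1_bar // expr1n; field.
have -> : 2%:R - (v + v^-1) = nm (v - 1) by rewrite nm_bar bt; field.
by rewrite -quart_re_ratio // -quart_reN bt; congr (quart_re _); field; rewrite oppr_eq0 v0 t0.
Qed.

(** If x is a nonsquare of E then - x is a square of E, and -1 is a square in K. *)
Lemma sqrt_E x : x \in E -> exists s, s ^+ 2 = x.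
Proof.
move=> xE; have [->|x0] := eqVneq x 0; first by exists 0; rewrite expr0n.
have hx : (x ^+ (uphalf (halfE q))) ^+ 2 = x * x ^+ halfE q.
  rewrite -exprM -exprS; congr (_ ^+ _).
  by rewrite muln2 uphalfK (odd_halfE q_mod4).
case: (quad_sign xE x0) => [[hE _]|[hE _]].
  by exists (x ^+ (uphalf (halfE q))); rewrite hx hE mulr1.
by exists (imag * x ^+ (uphalf (halfE q))); rewrite exprMn hx hE imag_sqr mulrN1 mulN1r opprK.
Qed.

(** The equation v + 1/v = b has two roots in K, inverse to each other.  They have norm one when
    b^2 - 4 is a nonsquare of E, and then [quart_re_U1] evaluates both terms.
    When b^2 - 4 is a nonzero square the roots lie in E, the sum is empty,
    and the right-hand side cancels because -1 is a nonsquare of E. *)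
Lemma sum_quart_re_fiber b : b \in E ->
  \sum_(v in U1 | v + v^-1 == b) quart_re v = quad (2%:R + b) + quad (2%:R - b).
Proof.
move=> bE; have two0 := two_neq0.
have twoE : 2%:R \in E by rewrite fixF_nat.
have sol (v w : K) : v != 0 -> w != 0 -> (v + v^-1 == w + w^-1) = (v == w) || (v == w^-1).
  move=> v0 w0; rewrite -subr_eq0.
  have -> : v + v^-1 - (w + w^-1) = (v - w) * (v - w^-1) / v by field; rewrite v0 w0.
  by rewrite !mulf_eq0 invr_eq0 (negbTE v0) orbF !subr_eq0.
(* For b = 2 or -2 the two roots coincide, and v = b / 2 is its own inverse. *)
have [/eqP b2|b2] := boolP (b ^+ 2 == 2%:R ^+ 2).
  have [w [w0 ww wb wU]] : exists w : K, [/\ w != 0, w^-1 = w, b = w + w^-1 & quart_re w = 1 /\ w \in U1].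
    move/eqP: b2; rewrite eqf_sqr => /orP[] /eqP ->; [exists 1 | exists (-1)].
      by rewrite oner_neq0 invr1 /quart_re quart1 eqxx inE expr1n; split => //; rewrite ?mulr2n.
    rewrite oppr_eq0 oner_neq0 invrN invr1 quart_reN /quart_re quart1 eqxx inE; split=> //.
      by rewrite -opprD mulr2n.
    by rewrite addn1 exprS frobnN // expr1n mulrNN mulr1.
  rewrite (big_pred1 w) => [|v].
    rewrite wU.1; move/eqP: b2; rewrite eqf_sqr => /orP[] /eqP ->.
      by rewrite subrr quad0 -natrD -[(2+2)%N]/(2*2)%N natrM -expr2 quad_square ?addr0.
    by rewrite subrr opprK quad0 -natrD -[(2+2)%N]/(2*2)%N natrM -expr2 quad_square ?add0r.
  rewrite /=; have [vU|vU] := boolP (v \in U1); last first.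
    by symmetry; apply: contraNF vU => /eqP ->; case: wU.
  by rewrite wb (sol _ _ (U1_neq0 vU) w0) ww orbb.
have dE : b ^+ 2 - 2%:R ^+ 2 \in E by rewrite fixFB ?fixFX.
have [s sE] := sqrt_E dE.
have s0 : s != 0.
  by apply: contra b2 => /eqP Es; rewrite -subr_eq0 -sE Es expr0n.
pose v := (b + s) / 2%:R.
have v0 : v != 0.
  apply/eqP => /eqP; rewrite mulf_eq0 invr_eq0 (negbTE two0) orbF addr_eq0 => /eqP bs.
  move: sE; rewrite bs sqrrN => /eqP; rewrite eq_sym -subr_eq0 addrC addKr oppr_eq0.
  by rewrite expf_eq0 (negbTE two0) andbF.
have vV : v^-1 = (b - s) / 2%:R.
  apply: (mulfI v0); rewrite divff //; apply/eqP.
  rewrite /v mulrACA [(b + s) * _]mulrC -subr_sqr sE -invfM opprB addrCA subrr addr0 -expr2.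
  by rewrite divff // expf_neq0.
have bv : b = v + v^-1 by rewrite vV /v; field.
have ns1 : v^-1 != v.
  rewrite vV /v (inj_eq (mulIf _)) ?invr_eq0 // (inj_eq (addrI b)).
  by rewrite eq_sym -addr_eq0 -mulr2n -mulr_natl mulf_neq0.
have : bar s ^+ 2 == s ^+ 2 by rewrite exprAC sE (fixFP _ _ _ dE).
rewrite eqf_sqr => /orP[] /eqP bs.
  have sF : s \in E by apply/fixFP.
  have vE : v \in E by rewrite /v fixF_div // fixFD.
  have UE x : x \in U1 -> x \in E -> x = x^-1.
    by move=> xU /fixFP xE; rewrite -U1_bar.
  rewrite big1 => [|x /andP[xU]].
    have bN0 : 2%:R - b != 0.
      by apply: contra b2; rewrite subr_eq0 => /eqP ->.
    have -> : 2%:R + b = - ((s / (2%:R - b)) ^+ 2 * (2%:R - b)).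
      by rewrite expr_div_n sE; field.
    have cE : 2%:R - b \in E by rewrite fixFB.
    have fE : s / (2%:R - b) \in E by rewrite fixF_div.
    have f0 : s / (2%:R - b) != 0 by rewrite mulf_neq0 ?invr_eq0.
    have f2E : (s / (2%:R - b)) ^+ 2 \in E by rewrite fixFX.
    have pE : (s / (2%:R - b)) ^+ 2 * (2%:R - b) \in E by rewrite fixFM.
    by rewrite quadNK // quadM // quad_square // mul1r addNr.
  rewrite bv (sol _ _ (U1_neq0 xU) v0) => xv.
  have xE : x \in E by case/orP: xv => /eqP ->; rewrite ?fixFV.
  have xx := UE _ xU xE; move: ns1; case/orP: xv => /eqP xv.
    by rewrite -xv -xx eqxx.
  by rewrite -[X in _ != X]invrK -xv -xx eqxx.
have bvV : bar v = v^-1.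
  rewrite vV /v exprMn frobnD // (fixFP _ _ _ bE) bs exprVn.
  by rewrite (fixFP _ _ _ twoE).
have vU : v \in U1 by rewrite inE nm_bar bvV divff.
have vVU : v^-1 \in U1 by rewrite inE exprVn nm_bar bvV divff // invr1.
have vP : (v \in U1) && (v + v^-1 == b) by rewrite vU -bv eqxx.
rewrite (bigD1 v vP) /= (big_pred1 v^-1) => [|x]; last first.
  rewrite /= [in _ == b]bv; have [xU|xU] /= := boolP (x \in U1).
    rewrite (sol _ _ (U1_neq0 xU) v0); have [->|_] /= := eqVneq x v; last by rewrite andbT.
    by rewrite eq_sym (negbTE ns1).
  by symmetry; apply: contraNF xU => /eqP ->.
have v2 : v ^+ 2 != 1.
  by apply: contra ns1 => /eqP vv; apply/eqP/(mulfI v0); rewrite divff // -expr2 vv.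
have vV2 : v^-1 ^+ 2 != 1 by rewrite exprVn invr_eq1.
by rewrite (quart_re_U1 vU v2).1 (quart_re_U1 vVU vV2).2 invrK [v^-1 + v]addrC -bv.
Qed.

End Characters.

(** * Gram determinants and hyperplane sums *)

(** The Gram determinant of three vectors for the standard form is the square of their
    determinant.  Applied to conjugates, the standard form is the trace form. *)
Lemma gram_det (R : comPzRingType) (x0 x1 x2 y0 y1 y2 z0 z1 z2 : R) :
  let p := x0 * x0 + x1 * x1 + x2 * x2 in
  let r := y0 * y0 + y1 * y1 + y2 * y2 in
  let s := z0 * z0 + z1 * z1 + z2 * z2 in
  let a := x0 * y0 + x1 * y1 + x2 * y2 in
  let b := y0 * z0 + y1 * z1 + y2 * z2 in
  let c := x0 * z0 + x1 * z1 + x2 * z2 in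
  (x0 * (y1 * z2 - y2 * z1) - x1 * (y0 * z2 - y2 * z0) + x2 * (y0 * z1 - y1 * z0)) ^+ 2 =
  p * r * s + 2%:R * a * b * c - p * b ^+ 2 - r * c ^+ 2 - s * a ^+ 2.
Proof. by move=> p r s a b c; rewrite /p /r /s /a /b /c; ring. Qed.

Section HyperplaneSums.
Variables (K : finFieldType) (q : nat) (g : K).
Hypothesis q_mod4 : (q = 3 %[mod 4])%N.
Hypothesis frobD : forall x y : K, (x + y) ^+ q = x ^+ q + y ^+ q.
Hypothesis card_K : #|K| = (q ^ 6)%N.
Hypothesis prim_g : (q ^ 6 - 1)%N.-primitive_root g.

Local Notation E := (fixF K q 3).
Local Notation Fq := (fixF K q 1).
Local Notation bar x := (x ^+ (q ^ 3)).
Local Notation nm x := (x ^+ (q ^ 3 + 1)).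
Local Notation Tr3 x := (trace q 3 x).
Local Notation Tr6 x := (trace q 6 x).
Local Notation quad := (quad q).
Local Notation quart_re := (quart_re q).
Local Notation U1 := (U1 K q).

(** The trace is a polynomial function of degree q^n. *)
Lemma card_trace_roots n : (#|[set x : K | (trace q n.+1 x == 0)%R]| <= q ^ n)%N.
Proof.
pose p : {poly K} := \sum_(i < n.+1) 'X^(q ^ i).
have sz : size p = (q ^ n).+1.
  rewrite /p big_ord_recr /= addrC size_polyDl size_polyXn // ltnS.
  apply: (leq_trans (size_sum _ _ _)); apply/bigmax_leqP => i _.
  by rewrite size_polyXn ltn_exp2l // (ltn_trans _ (q_gt2 q_mod4)).
have p0 : p != 0 by rewrite -size_poly_eq0 sz.
rewrite cardE -ltnS -sz max_poly_roots ?enum_uniq //.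
apply/allP => x; rewrite mem_enum inE /root => /eqP tx.
rewrite /p horner_sum -[X in _ == X]tx; apply/eqP/eq_bigr => i _.
by rewrite hornerXn.
Qed.

Lemma card_trace_fiber n (a c : K) : (0 < n)%N -> #|fixF K q n| = (q ^ n)%N ->
  a \in fixF K q n -> a != 0 -> c \in Fq ->
  #|[set x in fixF K q n | trace q n (a * x) == c]| = (q ^ n.-1)%N.
Proof.
case: n => // n _ cn aF a0 cF; rewrite [n.+1.-1]/=.
have [x0 x0F t0] : exists2 x, x \in fixF K q n.+1 & trace q n.+1 (a * x) != 0.
  apply/exists_inP; rewrite -negb_forall_in; apply/negP => /forall_inP al0.
  have := card_trace_roots n; rewrite leqNgt => /negP; apply.
  rewrite (@leq_trans #|fixF K q n.+1|) //.
    by rewrite cn ltn_exp2l // (ltn_trans _ (q_gt2 q_mod4)).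
  apply: subset_leq_card; apply/subsetP => x xF; rewrite inE.
  rewrite -[x](mulfVK a0) mulrC.
  by have := al0 (x / a); rewrite fixF_div //; apply.
apply/eqP; rewrite -(eqn_pmul2l (_ : 0 < q)%N); last by rewrite (ltn_trans _ (q_gt2 q_mod4)).
rewrite -expnS -cn -{1}(card_Fq q_mod4 prim_g).
rewrite (@card_slide _ _ q_mod4 frobD _ x0 _ _ (fun=> trace q n.+1 (a * x0))) ?fixF0 //.
- by move=> x xF; apply: trace_fixF1 => //; apply: fixFM.
- by move=> x xF; split=> //; apply: trace_fixF1 => //; apply: fixFM.
move=> x t xF tF; rewrite fixFD ?fixFM ?(fixF1_sub _ tF) //.
by split=> //; rewrite mulrDr traceD // mulrCA (traceZ _ _ tF).
Qed.

Lemma card_kernel3 (a : K) : a \in E -> a != 0 ->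
  #|[set x in E | Tr3 (a * x) == 0]| = (q ^ 2)%N.
Proof. by move=> aE a0; rewrite card_trace_fiber ?fixF0 ?(card_E q_mod4 prim_g). Qed.

(** The sum of the quadratic character over the affine plane
    Tr(a x) = 2 Tr(a) of E, parametrised by x = 2 + b. *)
Definition plane_sum (a : K) : int :=
  \sum_(b in E | Tr3 (a * b) == 0) quad (2%:R + b).

(** For v of norm one, a v + bar (a v) = a (v + 1/v); grouping by the value of
    v + 1/v gives the plane sum and its image under b -> - b. *)
Lemma sum_quart_re_U1 a : a \in E ->
  \sum_(v in U1 | Tr6 (a * v) == 0) quart_re v = plane_sum a *+ 2.
Proof.
move=> aE.
have vE v : v \in U1 -> v + v^-1 \in E.
  move=> vU; apply/fixFP; rewrite frobnD // exprVn (U1_bar vU) invrK addrC //.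
have tr6 v : v \in U1 -> Tr6 (a * v) = Tr3 (a * (v + v^-1)).
  by move=> vU; rewrite trace6E // exprMn (fixFP _ _ _ aE) (U1_bar vU) mulrDr.
rewrite (partition_big (fun v => v + v^-1) (fun b => (b \in E) && (Tr3 (a * b) == 0))) /=; last first.
  by move=> v /andP[vU]; rewrite tr6 // vE.
(* The hyperplane of b is stable under b -> - b. *)
have symP : plane_sum a = \sum_(b in E | Tr3 (a * b) == 0) quad (2%:R - b).
  rewrite /plane_sum (reindex_inj oppr_inj) /=; apply: eq_bigl => b.
  by rewrite fixFN // mulrN traceN // oppr_eq0.
rewrite mulr2n {2}symP /plane_sum.
rewrite -big_split /=; apply: eq_bigr => b /andP[bE tb].
rewrite -(sum_quart_re_fiber q_mod4 frobD card_K prim_g bE); apply: eq_bigl => v.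
have [vU|//] /= := boolP (v \in U1).
by have [e|_] := eqVneq (v + v^-1) b; rewrite ?andbF // tr6 // e tb.
Qed.

Definition normFq : {set K} := [set v | (v != 0) && (nm v \in Fq)].

(** A nonzero value of [quart_re] means that v is a square in K, so that its norm
    is a square in E, and also in F_q since the index N of the unit groups is odd. *)
Lemma quart_re_square v : v \in normFq -> quart_re v != 0 ->
  #|[set c in Fq | c ^+ 2 == nm v]| = 2%N.
Proof.
rewrite inE => /andP[v0 vF] rv.
have n0 : nm v != 0 by rewrite expf_neq0.
set b := nm v in vF n0 *.
have qb : quart q v ^+ 2 = 1.
  move: rv; rewrite /quart_re; case: (quart q v =P 1) => [-> _|_]; first by rewrite expr1n.
  by case: (quart q v =P -1) => [-> _|_]; rewrite ?eqxx // sqrrN expr1n.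
have bh2 : (b ^+ halfF q) ^+ 2 = 1.
  apply: (mulIf n0); rewrite mul1r -exprM -exprSr mulnC -addn1 -(q_halfF q_mod4).
  by have /fixFP := vF; rewrite expn1.
have bh : b ^+ halfF q = 1.
  have /eqP := bh2; rewrite sqrf_eq1 => /orP[/eqP //|/eqP bm].
  move: qb; rewrite (quart_sqr q_mod4) -/b (halfE_norm q_mod4) exprM bm.
  by rewrite -signr_odd (odd_NN q_mod4) expr1 => /eqP; rewrite (negbTE (opp1_neq1 q_mod4 prim_g)).
(* As (q - 1) / 2 is odd, b^((q + 1) / 4) is a square root of a square b. *)
pose c := b ^+ uphalf (halfF q).
have c2 : c ^+ 2 = b.
  by rewrite -exprM muln2 uphalfK (odd_halfF q_mod4) add1n exprS bh mulr1.
have c0 : c != 0 by rewrite expf_neq0.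
have -> : [set c in Fq | c ^+ 2 == b] = [set c; - c].
  have cF : c \in Fq by apply: fixFX.
  apply/setP=> x; rewrite in_set2 inE -c2 eqf_sqr.
  by apply: andb_idl => /orP[] /eqP ->; rewrite ?fixFN.
rewrite cards2 -addr_eq0 -mulr2n -mulr_natl mulf_neq0 //.
by rewrite (two_neq0 q_mod4 prim_g).
Qed.

Lemma normFqP v : reflect (v != 0 /\ nm v \in Fq) (v \in normFq).
Proof. by rewrite [v \in normFq]in_set; apply: andP. Qed.

Lemma normFqM u v : u \in normFq -> v \in normFq -> u * v \in normFq.
Proof.
move=> /normFqP[u0 uF] /normFqP[v0 vF]; apply/normFqP.
by rewrite mulf_neq0 // exprMn fixFM.
Qed.

Lemma normFqV v : v \in normFq -> v^-1 \in normFq.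
Proof. by move=> /normFqP[v0 vF]; apply/normFqP; rewrite invr_eq0 exprVn fixFV. Qed.

Lemma Fq_norm c : c \in Fq -> nm c = c ^+ 2.
Proof. by move=> /(fixF1_sub 3)/fixFP cE; rewrite nm_bar cE. Qed.

Lemma Fq_normFq c : c \in Fq -> c != 0 -> c \in normFq.
Proof. by move=> cF c0; apply/normFqP; rewrite Fq_norm // fixFX. Qed.

Lemma quart_Fq c : c \in Fq -> c != 0 -> quart q c = 1.
Proof. by move=> cF; apply: quart_E => //; apply: fixF1_sub. Qed.

(** The product map from (units of F_q) x (norm-one elements) is two-to-one onto the
    elements of [normFq] where [quart_re] does not vanish; both [quart_re] and the
    trace condition are invariant under the units of F_q. *)
Lemma sum_quart_re_normFq a :
  (\sum_(v in normFq | Tr6 (a * v) == 0) quart_re v) *+ 2 =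
  (\sum_(v in U1 | Tr6 (a * v) == 0) quart_re v) *+ (q - 1).
Proof.
have cF : #|[set c in Fq | c != 0]| = (q - 1)%N.
  have -> : [set c in Fq | c != 0] = Fq :\ 0 by apply/setP=> c; rewrite !inE andbC.
  have := cardsD1 0 Fq; rewrite fixF0 // (card_Fq q_mod4 prim_g) /=.
  by move: #|_| => n; lia.
pose F (c v : K) := quart_re v *+ (c ^+ 2 == nm v).
transitivity (\sum_(c in [set c in Fq | c != 0]) \sum_(v in normFq | Tr6 (a * v) == 0) F c v).
  rewrite exchange_big /= -sumrMnl; apply: eq_bigr => v /andP[vV _].
  rewrite sumrMnr; have [->|r0] := eqVneq (quart_re v) 0; first by rewrite !mul0rn.
  rewrite -[in LHS](quart_re_square vV r0) -sum1_card; congr (_ *+ _).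
  rewrite big_mkcond [in RHS]big_mkcond /=; apply: eq_bigr => c _; rewrite !in_set.
  have [|] //= := boolP (c ^+ (q ^ 1) == c); have [->|] //= := eqVneq c 0.
  case/normFqP: vV => v0 _ _; rewrite [0 ^+ 2]expr0n /= [_ == nm v]eq_sym.
  by rewrite expf_eq0 (negbTE v0) andbF.
rewrite -cF -sumr_const; apply: eq_bigr => c; rewrite inE => /andP[cFq c0].
rewrite /F (reindex_inj (mulfI c0)) /= big_mkcond [RHS]big_mkcond /=.
apply: eq_bigr => v _; rewrite mulrCA traceZ // mulf_eq0 (negbTE c0) /=.
rewrite /quart_re quartM quart_Fq // mul1r exprMn Fq_norm // [v \in U1]in_set.
rewrite [c ^+ 2 == _]eq_sym mulr_eq_self ?expf_neq0 //.
have [v1|_] := eqVneq (nm v) 1; last by rewrite mulr0n; case: ifP.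
have v0 : v != 0.
  by apply: contra_eq_neq v1 => ->; rewrite expr0n addn1 eq_sym oner_eq0.
have -> : c * v \in normFq by apply/normFqP; rewrite mulf_neq0 // exprMn v1 mulr1 Fq_norm ?fixFX.
by [].
Qed.

Lemma card_sqrtE x : x \in E -> #|[set y in E | y ^+ 2 == x]|%:R = 1 + quad x.
Proof.
move=> xE; have [->|x0] := eqVneq x 0.
  rewrite quad0 addr0 (_ : [set _ in _ | _] = [set 0]) ?cards1 //.
  apply/setP=> y; rewrite in_set1 inE expf_eq0 /=; apply: andb_idl => /eqP ->.
  exact: fixF0.
have yes y : y \in E -> y ^+ 2 = x -> #|[set y in E | y ^+ 2 == x]|%:R = 1 + quad x.
  move=> yE yx; have y0 : y != 0 by apply: contra x0 => /eqP y0; rewrite -yx y0 expr0n.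
  rewrite -yx (quad_square q_mod4 prim_g) //.
  have -> : [set y0 in E | y0 ^+ 2 == y ^+ 2] = [set y; - y].
    apply/setP=> t; rewrite in_set2 inE eqf_sqr.
    by apply: andb_idl => /orP[] /eqP ->; rewrite ?fixFN.
  have yN : y != - y.
    by rewrite -addr_eq0 -mulr2n -mulr_natl mulf_neq0 // (two_neq0 q_mod4 prim_g).
  by rewrite cards2 yN.
have [/exists_inP[y yE /eqP yx]|no] := boolP [exists y in E, y ^+ 2 == x].
  exact: yes yE yx.
case: (quad_sign q_mod4 prim_g xE x0) => -[xh qx].
  case/exists_inP: no; exists (x ^+ uphalf (halfE q)); first exact: fixFX.
  by rewrite -exprM muln2 uphalfK (odd_halfE q_mod4) add1n exprS xh mulr1.
rewrite qx subrr (_ : [set _ in _ | _] = set0) ?cards0 //.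
apply/setP=> y; rewrite in_set0 inE; apply: contraNF no => /andP[yE yx].
by apply/exists_inP; exists y.
Qed.

(** The Gram determinant of the trace form is a square in E. *)
Lemma det_E x y z : x \in E -> y \in E -> z \in E ->
  exists2 D : K, D \in E & D ^+ 2 =
    Tr3 (x * x) * Tr3 (y * y) * Tr3 (z * z)
    + 2%:R * Tr3 (x * y) * Tr3 (y * z) * Tr3 (x * z)
    - Tr3 (x * x) * Tr3 (y * z) ^+ 2 - Tr3 (y * y) * Tr3 (x * z) ^+ 2
    - Tr3 (z * z) * Tr3 (x * y) ^+ 2.
Proof.
move=> xE yE zE; rewrite !trace3E !exprMn -gram_det; eexists; last by [].
by do ?[apply: fixFB => //|apply: fixFD => //|apply: fixFM => //|apply: fixFX => //].
Qed.

(** Take z1 with a = Tr(z0 z1) nonzero.  If Tr(y^2) were 1, the Gram determinant of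
    z0, z1, y would be - a^2, a nonsquare of E. *)
Lemma anisotropic_plane z0 y : z0 \in E -> z0 != 0 -> Tr3 (z0 * z0) = 0 ->
  y \in E -> Tr3 (z0 * y) = 0 -> Tr3 (y * y) != 1.
Proof.
move=> zE z00 tz yE tzy; apply/eqP => ty.
(* Otherwise the hyperplane of z0 would be all of E. *)
have [z1 z1E az] : exists2 z1, z1 \in E & Tr3 (z0 * z1) != 0.
  apply/exists_inP; rewrite -negb_forall_in; apply/negP => /forall_inP al0.
  have := card_kernel3 zE z00; have -> : [set x in E | Tr3 (z0 * x) == 0] = E.
    by apply/setP=> x; rewrite inE; apply: andb_idr; apply: al0.
  rewrite (card_E q_mod4 prim_g) => /eqP; rewrite eqn_exp2l //.
  exact: ltn_trans (q_gt2 q_mod4).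
have [D DE] := det_E zE z1E yE; rewrite tz tzy ty => D2.
have {}D2 : D ^+ 2 = - Tr3 (z0 * z1) ^+ 2 by rewrite D2; ring.
have aE : Tr3 (z0 * z1) \in E by apply/fixF1_sub/trace_fixF1 => //; apply: fixFM.
have fE : D / Tr3 (z0 * z1) \in E by apply: fixF_div.
have D0 : D != 0.
  apply/eqP => D0; move: D2; rewrite D0 expr0n /= => /esym/eqP.
  by rewrite oppr_eq0 expf_eq0 (negbTE az).
have := @quad_square _ _ _ q_mod4 prim_g _ fE; rewrite mulf_neq0 ?invr_eq0 // => /(_ isT).
rewrite expr_div_n D2 mulNr divff ?expf_neq0 // (quadNK q_mod4 prim_g) ?fixF1 //.
by rewrite /quad oner_eq0 expr1n eqxx.
Qed.

(** Sliding along the isotropic vector z0 takes the value 1 once in every q vectors not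
    orthogonal to z0, and [anisotropic_plane] excludes the others. *)
Lemma card_quadric_one z0 : z0 \in E -> z0 != 0 -> Tr3 (z0 * z0) = 0 ->
  #|[set y in E | Tr3 (y * y) == 1]| = (q ^ 2 - q)%N.
Proof.
move=> zE z00 tz.
have q0 : (0 < q)%N by apply: ltn_trans (q_gt2 q_mod4).
pose A := [set x in E | Tr3 (z0 * x) != 0].
have AP y : reflect (y \in E /\ Tr3 (z0 * y) != 0) (y \in A).
  by rewrite [y \in A]in_set; apply: andP.
have cA : #|A| = (q ^ 3 - q ^ 2)%N.
  rewrite -(card_E q_mod4 prim_g) -(card_kernel3 zE z00) -cardsDS.
    by apply: eq_card => x; rewrite !inE; case: (bar x == x); rewrite ?andbT ?andbF.
  by apply/subsetP=> x; rewrite in_set => /andP[].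
have -> : [set y in E | Tr3 (y * y) == 1] = [set y in A | Tr3 (y * y) == 1].
  apply/setP=> y; apply/setIdP/setIdP => -[yE ty]; split=> //.
    apply/AP; split=> //; apply: contraL ty => /eqP.
    exact: anisotropic_plane.
  by case/AP: yE.
apply/eqP; rewrite -(eqn_pmul2l q0) mulnBr -expnS mulnn -cA.
rewrite -{1}(card_Fq q_mod4 prim_g).
rewrite (@card_slide _ _ q_mod4 frobD _ z0 _ _ (fun y => 2%:R * Tr3 (z0 * y))) ?fixF1 //.
- by move=> y /AP[yE _]; apply: trace_fixF1 => //; apply: fixFM.
- move=> y /AP[yE ty]; split; last by rewrite mulf_neq0 ?(two_neq0 q_mod4 prim_g).
  by apply: fixFM; [apply: fixF_nat | apply: trace_fixF1 => //; apply: fixFM].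
move=> y t /AP[yE ty] tF; have tE := fixF1_sub 3 tF; split.
  apply/AP; rewrite fixFD ?fixFM // mulrDr traceD // mulrCA (traceZ _ _ tF) tz mulr0 addr0.
  by split.
have -> : (y + t * z0) * (y + t * z0) = y * y + t * (2%:R * (z0 * y) + t * (z0 * z0)) by ring.
rewrite traceD // (traceZ _ _ tF) traceD // (traceZ _ _ tF) tz mulr0 addr0.
by rewrite (traceZ _ _ (fixF_nat _ _ _ 2)).
Qed.

End HyperplaneSums.

(** * Character sums over the conic *)

Section ConicSums.
Variables (K : finFieldType) (q : nat) (g : K).
Hypothesis q_mod4 : (q = 3 %[mod 4])%N.
Hypothesis frobD : forall x y : K, (x + y) ^+ q = x ^+ q + y ^+ q.
Hypothesis card_K : #|K| = (q ^ 6)%N.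
Hypothesis prim_g : (q ^ 6 - 1)%N.-primitive_root g.

Local Notation E := (fixF K q 3).
Local Notation Fq := (fixF K q 1).
Local Notation bar x := (x ^+ (q ^ 3)).
Local Notation nm x := (x ^+ (q ^ 3 + 1)).
Local Notation Tr3 x := (trace q 3 x).
Local Notation Tr6 x := (trace q 6 x).
Local Notation quad := (quad q).
Local Notation quart_re := (quart_re q).
Local Notation U1 := (U1 K q).
Local Notation normFq := (normFq K q).

(** Count the y with Tr(y^2) = 1 by their squares: x is the square of 1 + eta(x) elements,
    and the plane Tr(x) = 1 has q^2 points. *)
Lemma sum_quad_plane z0 : z0 \in E -> z0 != 0 -> Tr3 (z0 * z0) = 0 ->
  \sum_(x in E | Tr3 x == 1) quad x = - q%:R.
Proof.
move=> zE z00 tz.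
have card1 : #|[set x in E | Tr3 x == 1]| = (q ^ 2)%N.
  rewrite -(@card_trace_fiber _ _ _ q_mod4 frobD prim_g 3 1 1) ?fixF1 ?oner_neq0 ?(card_E q_mod4 prim_g) //.
  by apply: eq_card => x; rewrite !inE mul1r.
have : (#|[set y in E | Tr3 (y * y) == 1]|%:R : int) =
    \sum_(x in [set x in E | Tr3 x == 1]) (1 + quad x).
  rewrite -sumr_const (partition_big (fun y => y * y) (mem [set x in E | Tr3 x == 1])) /=; last first.
    by move=> y /setIdP[yE ty]; apply/setIdP; rewrite fixFM.
  apply: eq_bigr => x /setIdP[xE tx]; rewrite -(card_sqrtE q_mod4 prim_g xE).
  rewrite -sumr_const; apply: eq_bigl => y /=.
  apply/andP/setIdP => [[/setIdP[yE _] yx]|[yE]]; first by rewrite expr2.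
  by rewrite expr2 => /eqP yx; split; [apply/setIdP|]; rewrite yx.
rewrite (card_quadric_one q_mod4 frobD prim_g zE z00 tz).
rewrite big_split /= sumr_const card1 natrB; last first.
  by rewrite -[X in (X <= _)%N]expn1 leq_exp2l // (ltn_trans _ (q_gt2 q_mod4)).
by move/addrI => ->; apply: eq_bigl => x; apply/andP/setIdP.
Qed.

(** If Tr(a) = 0 the plane is symmetric and eta is odd.  Otherwise the homothety by
    2 Tr(a) / a maps the plane Tr(x) = 1 onto the given one. *)
Lemma plane_sumE z0 a : z0 \in E -> z0 != 0 -> Tr3 (z0 * z0) = 0 ->
  a \in E -> a != 0 ->
  plane_sum q a = if Tr3 a == 0 then 0 else - (quad (2%:R * a * Tr3 a) * q%:R).
Proof.
move=> zE z00 tz aE a0; have twoE : 2%:R \in E by apply: fixF_nat.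
have two0 := two_neq0 q_mod4 prim_g.
have tF : Tr3 a \in Fq by apply: trace_fixF1.
have tE := fixF1_sub 3 tF.
have twoF : 2%:R \in Fq by apply: fixF_nat.
have -> : plane_sum q a = \sum_(x in E | Tr3 (a * x) == 2%:R * Tr3 a) quad x.
  rewrite /plane_sum [RHS](reindex_inj (addrI 2%:R)) /=; apply: eq_bigl => x.
  have -> : (2%:R + x \in E) = (x \in E).
    by apply/idP/idP => xE; [rewrite -[x](addKr 2%:R) fixFD ?fixFN | rewrite fixFD].
  congr (_ && _); rewrite mulrDr traceD // [a * 2%:R]mulrC (traceZ _ _ twoF).
  by rewrite -[X in _ = (_ == X)]addr0 (inj_eq (addrI (2%:R * Tr3 a))).
have [t0|t0] := eqVneq (Tr3 a) 0.
  set S := \sum_(x in E | _) _; have : S = - S.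
    rewrite {1}/S (reindex_inj oppr_inj) /= -sumrN; apply: eq_big => x.
      by rewrite fixFN // mulrN traceN // t0 mulr0 oppr_eq0.
    by rewrite fixFN // => /andP[xE _]; rewrite (quadNK q_mod4 prim_g).
  by move: S; clear=> S; lia.
pose m := 2%:R * Tr3 a / a.
have mE : m \in E by rewrite fixF_div ?fixFM.
have m0 : m != 0 by rewrite !mulf_neq0 ?invr_eq0.
rewrite (reindex_inj (mulfI m0)) /=.
have -> : quad (2%:R * a * Tr3 a) = quad m.
  have -> : 2%:R * a * Tr3 a = m * a ^+ 2 by rewrite /m; field.
  by rewrite (quadM q_mod4 prim_g) ?fixFX // (quad_square q_mod4 prim_g) // mulr1.
rewrite -mulrN -(sum_quad_plane zE z00 tz) [RHS]mulr_sumr.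
apply: eq_big => [x|x /andP[xE _]].
  have -> : (m * x \in E) = (x \in E).
    by apply/idP/idP => xE; [rewrite -[x](mulKf m0) fixFM ?fixFV | rewrite fixFM].
  congr (_ && _); have -> : a * (m * x) = 2%:R * Tr3 a * x by rewrite /m; field.
  rewrite (traceZ _ _ (fixFM twoF tF)) -[X in _ == X]mulr1 (inj_eq (mulfI _)) //.
  by rewrite mulf_neq0.
rewrite (quadM q_mod4 prim_g) //; move: xE.
by move=> mxE; rewrite -[x](mulKf m0) fixFM ?fixFV.
Qed.

Section Conic.
Variables (I : finType) (i0 : I) (z : I -> K).
Hypothesis zE : forall i, z i \in E.
Hypothesis z_neq0 : forall i, z i != 0.
Hypothesis z_conic : forall i, Tr3 (z i * z i) = 0.
Hypothesis z_sep : forall i j, i != j -> Tr3 (z i * z j) != 0.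

(** The base point i0 needs its own clause since Tr(z0 z) vanishes there. *)
Definition conic_sign (i : I) : int :=
  if i == i0 then quad (2%:R * z i0) else quad (z i * Tr3 (z i0 * z i)).

Let TrzE i j : Tr3 (z i * z j) \in E.
Proof. by apply/fixF1_sub/trace_fixF1 => //; apply: fixFM. Qed.

(** For isotropic vectors the Gram determinant reduces to this product of three traces. *)
Lemma conic_triple i j k : i != j -> j != k -> i != k ->
  quad (2%:R * Tr3 (z i * z j) * Tr3 (z j * z k) * Tr3 (z i * z k)) = 1.
Proof.
move=> ij jk ik; have [D DE] := det_E q_mod4 frobD (zE i) (zE j) (zE k).
rewrite !z_conic !mul0r !subr0 add0r => D2.
rewrite -D2 (quad_square q_mod4 prim_g) //; apply/eqP => D0.
move: D2; rewrite D0 expr0n /= => /esym/eqP; rewrite !mulf_eq0.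
by rewrite (negbTE (two_neq0 q_mod4 prim_g)) (negbTE (z_sep ij)) (negbTE (z_sep jk)) (negbTE (z_sep ik)).
Qed.

(** Away from the base point the squares of eta(z_i) and eta(z_j) drop out and
    [conic_triple] applies to the base point, i and j; if one of them
    is the base point, every factor already occurs twice. *)
Lemma conic_sign_pair i j : i != j ->
  conic_sign i * conic_sign j * quad (2%:R * (z i * z j) * Tr3 (z i * z j)) = 1.
Proof.
have twoE : 2%:R \in E by apply: fixF_nat.
have two0 := two_neq0 q_mod4 prim_g.
have QM := quadM q_mod4 prim_g.
have QS x : x \in E -> x != 0 -> quad x * quad x = 1 by apply: (quad_sqr q_mod4 prim_g).
(* i and j are distinct, so at most one of them is the base point. *)
wlog ij0 : i j / i0 != j => [wl ij|].
  have [i0j|] := eqVneq i0 j; last by move/wl; apply.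
  have i0i : i0 != i by rewrite i0j eq_sym.
  rewrite [X in X * _]mulrC [z i * z j]mulrC; apply: wl => //; by rewrite eq_sym.
rewrite /conic_sign [j == i0]eq_sym (negbTE ij0) => ij.
have zz x y : x != y -> quad (Tr3 (z x * z y)) * quad (Tr3 (z x * z y)) = 1.
  by move=> xy; apply: QS => //; apply: z_sep.
have zi x : quad (z x) * quad (z x) = 1 by apply: QS.
have q2 := QS _ twoE two0.
have [<-|i0i] := eqVneq i i0.
  rewrite !QM ?fixFM //; move: (zz _ _ ij) (zi i) (zi j).
  move: (quad 2%:R) (quad (z i)) (quad (z j)) (quad (Tr3 _)) q2 => a b c d; nia.
rewrite eq_sym in i0i; have := conic_triple i0i ij ij0.
rewrite !QM ?fixFM //; move: (zi i) (zi j).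
move: (quad 2%:R) (quad (z i)) (quad (z j)) (quad (Tr3 _)) (quad (Tr3 _)) (quad (Tr3 _)) q2 => a b c d e f.
by move=> aa bb cc H; rewrite -[RHS]H -[RHS]mul1r -{1}bb -[RHS]mul1r -{1}cc; ring.
Qed.

Lemma conic_plane_sum :
  \sum_i \sum_j conic_sign i * conic_sign j * plane_sum q (z i * z j) =
  - (#|I| * (#|I| - 1) * q)%N%:R.
Proof.
transitivity (\sum_(i : I) - ((#|I| - 1) * q)%N%:R : int); last first.
  by rewrite sumr_const mulNrn -mulrnA mulnC mulnA.
apply: eq_bigr => i _; rewrite (bigD1 i) //=.
rewrite (plane_sumE (zE i) (z_neq0 i)) ?fixFM ?mulf_neq0 // z_conic eqxx mulr0 add0r.
rewrite (eq_bigr (fun=> - q%:R)) => [|j ji].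
  by rewrite sumr_const mulNrn -mulrnA mulnC (cardC1 i) subn1.
rewrite (plane_sumE (zE i) (z_neq0 i)) ?fixFM ?mulf_neq0 // (negbTE (z_sep _)) 1?eq_sym //.
by rewrite mulrN mulrA conic_sign_pair ?mul1r // eq_sym.
Qed.

End Conic.
End ConicSums.

(** * The correlation of the signs over the quadric *)

Section Correlation.
Variables (K : finFieldType) (q : nat) (g : K).
Hypothesis q_mod4 : (q = 3 %[mod 4])%N.
Hypothesis frobD : forall x y : K, (x + y) ^+ q = x ^+ q + y ^+ q.
Hypothesis card_K : #|K| = (q ^ 6)%N.
Hypothesis prim_g : (q ^ 6 - 1)%N.-primitive_root g.

Local Notation E := (fixF K q 3).
Local Notation Fq := (fixF K q 1).
Local Notation bar x := (x ^+ (q ^ 3)).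
Local Notation nm x := (x ^+ (q ^ 3 + 1)).
Local Notation Tr3 x := (trace q 3 x).
Local Notation Tr6 x := (trace q 6 x).
Local Notation quad := (quad q).
Local Notation quart_re := (quart_re q).
Local Notation quart := (quart q).
Local Notation imag := (imag q g).
Local Notation normFq := (normFq K q).

(** For u = g^n this is 1 exactly when n mod 4 is 0 or 3. *)
Definition sigma (x : K) : int := if (quart x == 1) || (quart x == - imag) then 1 else -1.

Lemma imag_neq : [/\ imag == 1 = false, imag == -1 = false, - imag == 1 = false,
  - imag == -1 = false & imag == - imag = false].
Proof.
have i2 := imag_sqr q_mod4 card_K prim_g; have m1 := opp1_neq1 q_mod4 prim_g.
have ne (x : K) : x ^+ 2 = 1 -> imag == x = false.
  by move=> x1; apply/eqP => ix; move: m1; rewrite -i2 ix x1 eqxx.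
have i1 : imag == 1 = false by rewrite ne ?expr1n.
have im : imag == -1 = false by rewrite ne ?sqrrN ?expr1n.
split=> //; rewrite ?eqr_oppLR ?opprK //.
rewrite -addr_eq0 -mulr2n -mulr_natl mulf_eq0 (negbTE (two_neq0 q_mod4 prim_g)).
by rewrite (negbTE (imag_neq0 prim_g)).
Qed.

(** sigma is the real part of (1 + i) chi for the complex quartic character chi with
    chi(g) = i.  Multiplication by t rotates chi by a quarter turn, so the two products
    add up to twice the real part of chi(u / v), and chi(bar v) is the inverse of chi(v). *)
Lemma sigma_correlation t u v : quart t = imag -> u != 0 -> v != 0 ->
  sigma (t * u) * sigma (t * v) + sigma u * sigma v = quart_re (u * bar v) *+ 2.
Proof.
move=> qt u0 v0; rewrite /sigma /quart_re !quartM (quart_bar q_mod4 card_K) // qt.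
have i2 : imag * imag = -1 by rewrite -expr2 (imag_sqr q_mod4 card_K prim_g).
have i0 := imag_neq0 prim_g.
have iV : imag^-1 = - imag by apply: (mulfI i0); rewrite divff // mulrN i2 opprK.
have m1 := negbTE (opp1_neq1 q_mod4 prim_g).
have m2 : 1 == -1 :> K = false by rewrite eq_sym.
have [n1 n2 n3 n4 n5] := imag_neq; have n6 : - imag == imag = false by rewrite eq_sym.
have n7 : 1 == - imag = false by rewrite eq_sym.
have n8 : -1 == - imag = false by rewrite eq_sym.
case: (quart_cases q_mod4 card_K prim_g u0) => ->;
case: (quart_cases q_mod4 card_K prim_g v0) => ->;
rewrite ?invrN ?invr1 ?iV ?(mulrNN, mulrN, mulNr, mulr1, mul1r, opprK, i2);
by rewrite ?opprK ?i2 ?opprK ?(eqxx, n1, n2, n3, n4, n5, n6, n7, n8, m1, m2).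
Qed.

(** An odd power of g has a quartic character of order four, and the power of norm -1
    with exponent (q^3 - 1) / 2 is one; passing to the inverse adjusts the sign. *)
Lemma twist_exists : exists2 t : K, nm t = -1 & quart t = imag.
Proof.
have i2 := imag_sqr q_mod4 card_K prim_g.
have i0 := imag_neq0 prim_g.
have iV : imag^-1 = - imag.
  by apply: (mulfI i0); rewrite divff // mulrN -expr2 i2 opprK.
set t := g ^+ halfE q.
have t_nm : nm t = -1.
  have /eqP : nm t ^+ 2 = 1.
    rewrite -!exprM [X in g ^+ X](_ : _ = q ^ 6 - 1)%N ?(prim_expr_order prim_g) //.
    have -> : (q ^ 6 - 1 = 2 * halfE q * (q ^ 3 + 1))%N.
      by rewrite q6_decomp {1}(q3_halfE q_mod4) addnK.
    by ring.
  rewrite sqrf_eq1 => /orP[/eqP tn|/eqP //].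
  have := dvdn_leq _ (_ : q ^ 6 - 1 %| halfE q * (q ^ 3 + 1))%N.
  rewrite (prim_order_dvd prim_g) exprM -/t tn eqxx => /(_ _ isT).
  have := prim_order_gt0 prim_g; rewrite (q6_quarter q_mod4) (q3_quarterU q_mod4).
  by move: (halfE q) (quarterU q) => a b; rewrite (mulnCA a 4 b); move: (a * b)%N; clear=> c; lia.
have : quart t = imag \/ quart t = - imag.
  rewrite quartX -/imag -[halfE q]odd_double_half (odd_halfE q_mod4) exprD -mul2n exprM i2 expr1.
  by rewrite -signr_odd; case: (odd _); rewrite ?expr1 ?expr0 ?mulrN1 ?mulr1; [right|left].
case=> qt; [by exists t | exists t^-1].
  by rewrite exprVn t_nm invrN invr1.
by rewrite quartV qt invrN iV opprK.
Qed.

Lemma card_normFq : #|normFq| = ((q ^ 3 + 1) * (q - 1))%N.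
Proof.
rewrite -[RHS](card_unity prim_g); last first.
  by rewrite q6_decomp (q3_norm q_mod4) mulnAC [((q - 1) * _)%N]mulnC dvdn_mulr.
apply: eq_card => v; apply/normFqP/idP => [[v0 vF]|].
  have n0 : nm v != 0 by rewrite expf_neq0.
  rewrite inE exprM; apply/eqP/(mulfI n0).
  have /fixFP := vF; rewrite expn1 -exprS subn1 prednK ?mulr1 //.
  exact: ltn_trans (q_gt2 q_mod4).
rewrite inE exprM => /eqP v1.
have q1 : (q = (q - 1).+1)%N by rewrite subn1 prednK // (ltn_trans _ (q_gt2 q_mod4)).
split; last by apply/fixFP; rewrite expn1 [X in _ ^+ X]q1 exprS v1 mulr1.
apply: contra_eq_neq v1 => ->; rewrite expr0n addn1 /= expr0n eq_sym.
have -> : (q - 1 == 0)%N = false by have := q_gt2 q_mod4; clear; lia.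
by rewrite oner_neq0.
Qed.

(** Averaging over the twist turns sigma(u) sigma(v) into [quart_re] of u * bar v;
    for fixed v the substitution w = u * bar v permutes [normFq]. *)
Lemma sum_sigma a : a \in E ->
  \sum_(u in normFq) \sum_(v in normFq | Tr6 (a * (u * bar v)) == 0) sigma u * sigma v =
  plane_sum q a * ((q ^ 3 + 1) * (q - 1) * (q - 1))%N%:R.
Proof.
move=> aE; set S := LHS.
have [t nt qt] := twist_exists.
have t0 : t != 0.
  by apply: contra_eq_neq nt => ->; rewrite expr0n addn1 /= eq_sym oppr_eq0 oner_eq0.
have tV : t \in normFq by apply/normFqP; rewrite nt fixFN ?fixF1.
have tVE u : (t * u \in normFq) = (u \in normFq).
  apply/idP/idP=> [tuV|uV]; last exact: normFqM.
  by rewrite -[u](mulKf t0) normFqM ?normFqV.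
(* Replacing u, v by t u, t v multiplies u * bar v by n(t) = -1. *)
have St : S = \sum_(u in normFq) \sum_(v in normFq | Tr6 (a * (u * bar v)) == 0)
    sigma (t * u) * sigma (t * v).
  rewrite /S (reindex_inj (mulfI t0)) /=; apply: eq_big => // u _.
  rewrite (reindex_inj (mulfI t0)) /=; apply: eq_bigl => v; rewrite tVE; congr (_ && _).
  have -> : a * (t * u * bar (t * v)) = - (a * (u * bar v)).
    by rewrite exprMn mulrACA -nm_bar nt; ring.
  by rewrite traceN // oppr_eq0.
have S2 : S *+ 2 = (\sum_(u in normFq) \sum_(v in normFq | Tr6 (a * (u * bar v)) == 0)
    quart_re (u * bar v)) *+ 2.
  rewrite mulr2n {1}St /S -big_split -sumrMnl /=; apply: eq_bigr => u /normFqP[u0 _].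
  rewrite -big_split -sumrMnl /=; apply: eq_bigr => v /andP[/normFqP[v0 _] _].
  exact: sigma_correlation.
have {S2}-> : S =
    \sum_(v in normFq) \sum_(u in normFq | Tr6 (a * (u * bar v)) == 0) quart_re (u * bar v).
  transitivity (\sum_(u in normFq) \sum_(v in normFq | Tr6 (a * (u * bar v)) == 0) quart_re (u * bar v)).
    by clear St; move: S2; move: S (\sum_(u in _) _); clear=> S S'; lia.
  rewrite (exchange_big_dep (mem normFq)) /= => [|u v uV /andP[vV _]] //.
  by apply: eq_bigr => v vV; apply: eq_bigl => u; rewrite vV.
rewrite (eq_bigr (fun=> plane_sum q a * (q - 1)%N%:R)) => [|v vV].
  by rewrite sumr_const card_normFq -mulrnAr -mulrnA; congr (_ * _%:R); rewrite mulnC.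
have v0 : v != 0 by case/normFqP: vV.
have bV : bar v \in normFq.
  by case/normFqP: vV => _ nF; apply/normFqP; rewrite expf_neq0 // exprAC fixFX.
have bV0 : bar v != 0 by rewrite expf_neq0.
have -> : \sum_(u in normFq | Tr6 (a * (u * bar v)) == 0) quart_re (u * bar v) =
    \sum_(w in normFq | Tr6 (a * w) == 0) quart_re w.
  rewrite [RHS](reindex_inj (mulIf bV0)) /=; apply: eq_bigl => u; congr (_ && _).
  apply/idP/idP=> [uV|uV]; first exact: normFqM.
  by rewrite -[u](mulfK bV0) normFqM ?normFqV.
have := sum_quart_re_normFq q_mod4 card_K prim_g a.
rewrite (sum_quart_re_U1 q_mod4 frobD card_K prim_g aE) -mulrnA mulnC mulrnA mulr_natr.
by move: (\sum_(_ in _ | _) _) (_ *+ (q - 1)); clear=> x y; lia.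
Qed.

Section Conic.
Variables (I : finType) (i0 : I) (z : I -> K).
Hypothesis zE : forall i, z i \in E.
Hypothesis z_neq0 : forall i, z i != 0.
Hypothesis z_conic : forall i, Tr3 (z i * z i) = 0.
Hypothesis z_sep : forall i j, i != j -> Tr3 (z i * z j) != 0.
Hypothesis card_I : #|I| = q.+1.

(** The signs of the conic points cancel those of the plane sums, so that only the
    off-diagonal pairs contribute, each by the same amount. *)
Lemma correlation_sum :
  \sum_i \sum_j \sum_(u in normFq) \sum_(v in normFq | Tr6 (z i * u * bar (z j * v)) == 0)
     (conic_sign q i0 z i * sigma u) * (conic_sign q i0 z j * sigma v) =
  - (q ^ 2 * (q - 1) * ((q ^ 3 + 1) * (q ^ 2 - 1)))%N%:R.
Proof.
transitivity (\sum_i \sum_j conic_sign q i0 z i * conic_sign q i0 z j * plane_sum q (z i * z j)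
   * ((q ^ 3 + 1) * (q - 1) * (q - 1))%N%:R).
  apply: eq_bigr => i _; apply: eq_bigr => j _.
  rewrite -mulrA -sum_sigma ?fixFM // mulr_sumr; apply: eq_bigr => u _.
  rewrite mulr_sumr; apply: eq_big => [v|v _]; last by rewrite mulrACA.
  congr (_ && _); rewrite exprMn (fixFP _ _ _ (zE j)).
  by congr (trace _ _ _ == 0); ring.
under eq_bigr do rewrite -mulr_suml.
rewrite -mulr_suml (conic_plane_sum q_mod4 frobD card_K prim_g) // card_I mulNr -natrM.
congr (- _%:R); rewrite subn1 /=.
have -> : (q ^ 2 - 1 = (q - 1) * (q + 1))%N by rewrite -[X in (_ - X)%N](exp1n 2) subn_sqr.
by move: (q - 1)%N (q ^ 3)%N => r s; rewrite -mulnn; ring.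
Qed.

End Conic.
End Correlation.

(** * The elliptic quadric and its polar form *)

Section Quadric.
Variables (q : nat) (F : finFieldType) (L : fieldExtType F).
Hypothesis card_F : #|F| = q.
Hypothesis q_mod4 : (q = 3 %[mod 4])%N.
Hypothesis dim_L : (\dim {:L} = 6)%N.
Local Notation K := (finvect_type L).

Local Notation Fq := (fixF K q 1).
Local Notation bar x := (x ^+ (q ^ 3)).
Local Notation Tr3 x := (trace q 3 x).
Local Notation Tr6 x := (trace q 6 x).

(** q is a power of the characteristic of F, which is that of L. *)
Lemma frobenius_additive (x y : K) : (x + y) ^+ q = x ^+ q + y ^+ q.
Proof.
apply: exprDn_pchar; have [p pr_p pF] := finPcharP F.
have -> : q = (p ^ logn p #|F|)%N by rewrite -card_F; apply: (card_pprimeChar pF).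
by rewrite pnatX pnatE // (pchar_lalg L) pF.
Qed.

Lemma card_sextic : #|K| = (q ^ 6)%N.
Proof.
rewrite -card_F -dim_L -[RHS](card_vspace (fullv : {vspace K})).
by apply: eq_card => x; rewrite memvf.
Qed.

Variable g : K.
Hypothesis prim_g : (q ^ 6 - 1)%N.-primitive_root g.

Lemma scale_Fq (c : F) : (c%:A : K) \in Fq.
Proof. by apply/fixFP; rewrite expn1 exprZn expr1n -card_F expf_card. Qed.

Lemma Fq_scale (t : K) : t \in Fq -> exists c : F, t = c%:A.
Proof.
have inj : injective (fun c : F => c%:A : K) by exact: (fmorph_inj (in_alg K)).
suff -> : Fq = [set c%:A | c : F] by case/imsetP=> c _ ->; exists c.
apply/esym/eqP; rewrite eqEcard card_imset // (card_Fq q_mod4 prim_g) card_F leqnn andbT.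
by apply/subsetP=> x /imsetP[c _ ->]; apply: scale_Fq.
Qed.

Definition polar (x y : K) : K := Tr6 (x * bar y).

Lemma fixF6 (x : K) : x \in fixF K q 6.
Proof. by apply/fixFP; rewrite -card_sextic expf_card. Qed.

Lemma polar_sym x y : polar x y = polar y x.
Proof.
rewrite /polar -(trace_frobn 3 (fixF6 (x * bar y))) exprMn -exprM -expnD mulrC.
by rewrite (fixFP _ _ _ (fixF6 y)).
Qed.

Lemma polarDl x y z : polar (x + y) z = polar x z + polar y z.
Proof. by rewrite /polar mulrDl traceD //; apply: frobenius_additive. Qed.

Lemma polarZl t x y : t \in Fq -> polar (t * x) y = t * polar x y.
Proof. by move=> tF; rewrite /polar -mulrA traceZ. Qed.

Lemma polarZr t x y : t \in Fq -> polar x (t * y) = t * polar x y.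
Proof. by move=> tF; rewrite polar_sym polarZl // polar_sym. Qed.

Lemma quadric_formD (x y : K) :
  quadric_form q (x + y) = quadric_form q x + quadric_form q y + polar x y.
Proof.
have fD := frobenius_additive.
rewrite /polar trace6E // exprMn -exprM -expnD (fixFP _ _ _ (fixF6 y)).
rewrite /quadric_form -!traceD // !addn1 !exprS frobnD //.
by congr (trace _ _ _); ring.
Qed.

Lemma quadric_formZ t x : t \in Fq -> quadric_form q (t * x) = t ^+ 2 * quadric_form q x.
Proof.
move=> tF; rewrite /quadric_form exprMn Fq_norm // traceZ ?fixFX //.
Qed.

Lemma polar_self x : polar x x = 2%:R * quadric_form q x.
Proof.
have := quadric_formD x x; have -> : x + x = 2%:R * x by ring.
rewrite quadric_formZ ?fixF_nat //; last exact: frobenius_additive.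
set Q := quadric_form q x => E; have -> : polar x x = Q + Q + polar x x - (Q + Q) by ring.
by rewrite -E; ring.
Qed.

Definition singular : {set K} := [set x | (x != 0) && (quadric_form q x == 0)].

Lemma singularP x : reflect (x != 0 /\ quadric_form q x = 0) (x \in singular).
Proof. by rewrite [x \in singular]in_set; apply: (iffP andP) => -[x0 /eqP]. Qed.

Lemma singularZ t x : t \in Fq -> t != 0 -> (t * x \in singular) = (x \in singular).
Proof.
by move=> tF t0; rewrite !in_set quadric_formZ // !mulf_eq0 (negbTE t0).
Qed.

Hypothesis card_singular : #|singular| = ((q ^ 3 + 1) * (q ^ 2 - 1))%N.

Lemma polar_Fq x y : polar x y \in Fq.
Proof. by apply: (trace_fixF1 q_mod4 frobenius_additive); apply: fixF6. Qed.

Lemma quadric_form_Fq x : quadric_form q x \in Fq.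
Proof.
apply: (trace_fixF1 q_mod4 frobenius_additive).
exact: nm_E card_sextic _.
Qed.

Let q0 : (0 < q)%N. Proof. exact: ltn_trans (q_gt2 q_mod4). Qed.

Lemma card_nonorthogonal (y : K) : y != 0 -> #|[set x | polar x y != 0]| = (q ^ 6 - q ^ 5)%N.
Proof.
move=> y0; have by0 : bar y != 0 by rewrite expf_neq0.
have c6 : #|fixF K q 6| = (q ^ 6)%N.
  by rewrite -card_sextic; apply: eq_card => x; rewrite fixF6.
rewrite -[X in (X - _)%N]c6.
rewrite -(card_trace_fiber q_mod4 frobenius_additive prim_g (isT : 0 < 6)%N c6 (fixF6 (bar y)) by0
  (fixF0 K q_mod4 1)) -cardsDS.
  apply: eq_card => x; rewrite [LHS]in_set in_setD fixF6 andbT /polar mulrC.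
  congr (~~ _); apply/idP/setIdP=> [p0|[]//]; split=> //; exact: fixF6.
by apply/subsetP=> x; rewrite fixF6.
Qed.

(** Sliding along y: the polar form with y is the slope of the quadratic form in
    the direction of y. *)
Lemma card_singular_nonorthogonal y : y \in singular ->
  #|[set x in singular | polar x y != 0]| = (q ^ 5 - q ^ 4)%N.
Proof.
move=> /singularP[y0 Qy].
have fD := frobenius_additive.
have -> : [set x in singular | polar x y != 0] =
    [set x in [set x | polar x y != 0] | quadric_form q x == 0].
  apply/setP=> x; apply/setIdP/setIdP => -[].
    by move=> /singularP[_ ->] px; rewrite inE.
  rewrite inE => px /eqP Qx; split=> //; apply/singularP; split=> //.
  by apply: contra px => /eqP->; rewrite /polar mul0r trace0.
apply/eqP; rewrite -(eqn_pmul2l q0) mulnBr -!expnS -(card_nonorthogonal y0) -{1}(card_Fq q_mod4 prim_g).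
apply/eqP/(@card_slide _ _ q_mod4 fD _ y 0 (quadric_form q) (fun x => polar x y)); last exact: fixF0.
- by move=> x _; apply: quadric_form_Fq.
- by move=> x; rewrite inE => px; split=> //; apply: polar_Fq.
move=> x t; rewrite inE => px tF; rewrite inE polarDl polarZl // polar_self Qy !mulr0 addr0 px.
split=> //; rewrite quadric_formD quadric_formZ // Qy mulr0 addr0 polarZr //.
Qed.

End Quadric.

(** * Totally singular lines *)

Section Lines.
Variables (q : nat) (F : finFieldType) (L : fieldExtType F).
Hypothesis card_F : #|F| = q.
Hypothesis q_mod4 : (q = 3 %[mod 4])%N.
Hypothesis dim_L : (\dim {:L} = 6)%N.
Local Notation K := (finvect_type L).
Variable g : K.
Hypothesis prim_g : (q ^ 6 - 1)%N.-primitive_root g.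
Local Notation Fq := (fixF K q 1).
Local Notation singular := (@singular q F L).
Local Notation polar := (@polar q F L).
Local Notation lines := (quadric_lines L q).
Hypothesis card_singular : #|singular| = ((q ^ 3 + 1) * (q ^ 2 - 1))%N.

Let q0 : (0 < q)%N. Proof. exact: ltn_trans (q_gt2 q_mod4). Qed.

Lemma linesP (l : {vspace K}) :
  reflect (\dim l = 2%N /\ forall x, x \in l -> quadric_form q x = 0) (l \in lines).
Proof.
rewrite inE; apply: (iffP andP) => [[/eqP d /forallP s]|[d s]]; split; rewrite ?d //.
  by move=> x xl; apply/eqP; have := s x; rewrite xl.
by apply/forallP => x; apply/implyP => xl; rewrite s.
Qed.

Lemma line_singular l x : l \in lines -> x \in l -> x != 0 -> x \in singular.
Proof. by move=> /linesP[_ s] xl x0; apply/singularP; rewrite s. Qed.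

Lemma card_line_minus_point l (y : K) : l \in lines -> y \in l -> y != 0 ->
  #|[set x | (x \in l) && (x \notin <[y]>%VS)]| = (q ^ 2 - q)%N.
Proof.
move=> /linesP[d _] yl y0.
have cl : #|l| = (q ^ 2)%N by rewrite card_vspace card_F d.
have cy : #|<[y]>%VS| = q by rewrite card_vspace card_F dim_vline y0 expn1.
have sub : {subset <[y]>%VS <= l} by apply/subvP; rewrite -memvE.
have := cardID (mem <[y]>%VS) (mem l); rewrite cl => <-.
have -> : #|[predI mem l & mem <[y]>%VS]| = q.
  rewrite -[RHS]cy; apply: eq_card => x; rewrite !inE; apply: andb_idl; exact: sub.
rewrite addKn; apply: eq_card => x; by rewrite !inE andbC.
Qed.

Lemma mem_vline_Fq (x y : K) : reflect (exists2 t, t \in Fq & x = t * y) (x \in <[y]>%VS).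
Proof.
apply: (iffP (vlineP _ _)) => [[c ->]|[t tF ->]].
  by exists (c%:A); rewrite ?mulr_algl //; apply: scale_Fq.
by have [c ->] := Fq_scale card_F q_mod4 prim_g tF; exists c; rewrite mulr_algl.
Qed.

(** A line containing both must be their span, and that span is totally singular if and
    only if the two vectors are orthogonal. *)
Lemma card_lines_through_pair (y z : K) : y \in singular -> z \in singular -> z \notin <[y]>%VS ->
  #|[set l in lines | (y \in l) && (z \in l)]| = (polar y z == 0).
Proof.
move=> /singularP[y0 Qy] /singularP[z0 Qz] nzy.
have fD := frobenius_additive card_F.
pose U : {vspace K} := (<[y]> + <[z]>)%VS.
have yU : y \in U by rewrite memvE addvSl.
have zU : z \in U by rewrite memvE addvSr.
have dU : \dim U = 2%N.
  have le2 : (\dim U <= 2)%N.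
    by apply: leq_trans (dimv_add_leqif _ _) _; rewrite !dim_vline y0 z0.
  have [] := dimv_leqif_sup (addvSl <[y]>%VS <[z]>%VS).
  rewrite dim_vline y0 -/U leq_eqVlt => le1 e; move: le1; rewrite {}e.
  case/orP=> [Uy|]; last by move=> ?; apply/eqP; rewrite eqn_leq le2.
  by case/negP: nzy; apply: (subvP Uy).
have only l : l \in lines -> y \in l -> z \in l -> l = U /\ polar y z = 0.
  move=> /linesP[d s] yl zl; split; last first.
    have := quadric_formD card_F dim_L y z.
    by rewrite !s ?memvD // !add0r => ->.
  apply/esym/eqP; rewrite eqEdim d dU leqnn andbT subv_add -!memvE yl zl.
  by [].
have [p0|pn0] := eqVneq (polar y z) 0; last first.
  by apply: eq_card0 => l; apply/setIdP => -[ll /andP[yl zl]];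
    have [_ p0] := only _ ll yl zl; rewrite p0 eqxx in pn0.
rewrite (_ : [set _ in _ | _] = [set U]) ?cards1 //.
apply/setP=> l; rewrite in_set1; apply/setIdP/eqP => [[ll /andP[yl zl]]|->].
  by have [] := only _ ll yl zl.
rewrite yU zU; split=> //; apply/linesP; split=> // x /memv_addP[u uy [v vz ->]].
have [a aF ->] := mem_vline_Fq _ _ uy; have [b bF ->] := mem_vline_Fq _ _ vz.
rewrite (quadric_formD card_F dim_L) !quadric_formZ //.
by rewrite polarZl // polarZr // p0 Qy Qz !mulr0 !addr0.
Qed.

Lemma singular_vline (y : K) : y \in singular ->
  [set z in singular | z \in <[y]>%VS] = [set z | z \in <[y]>%VS] :\ 0.
Proof.
move=> yS; have [y0 Qy] := singularP _ _ yS.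
apply/setP=> z; apply/setIdP/setD1P => [[/singularP[z0 _] zy]|[z0]].
  by rewrite inE.
rewrite inE => zy; split=> //; apply/singularP; split=> //.
by have [t tF ->] := mem_vline_Fq _ _ zy; rewrite quadric_formZ // Qy mulr0.
Qed.

Lemma card_singular_vline (y : K) : y \in singular ->
  #|[set z in singular | z \in <[y]>%VS]| = (q - 1)%N.
Proof.
move=> yS; have [y0 Qy] := singularP _ _ yS.
have := cardsD1 0 [set z | z \in <[y]>%VS].
rewrite singular_vline // inE mem0v add1n => E.
have -> : q = #|[set z | z \in <[y]>%VS]|.
  by rewrite cardsE card_vspace card_F dim_vline y0 expn1.
by rewrite E subn1.
Qed.

Lemma polar_vline (y z : K) : y \in singular -> z \in <[y]>%VS -> polar y z = 0.
Proof.
move=> /singularP[y0 Qy] /mem_vline_Fq[t tF ->].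
by rewrite polarZr // polar_self // Qy !mulr0.
Qed.

(** Each singular vector orthogonal to y and not proportional to it lies on a single
    line through y, and a line through y contains q^2 - q of them. *)
Lemma card_lines_through (y : K) : y \in singular ->
  #|[set l in lines | y \in l]| = (q ^ 2 + 1)%N.
Proof.
move=> yS; have [y0 Qy] := singularP _ _ yS.
have q2 := q_gt2 q_mod4.
pose A := [set z in singular | (polar y z == 0) && (z \notin <[y]>%VS)].
have cA : #|A| = ((q ^ 2 + 1) * (q ^ 2 - q))%N.
  have c1 := card_singular_nonorthogonal card_F q_mod4 dim_L prim_g yS.
  have c2 := card_singular_vline yS.
  have : #|singular| = (#|[set z in singular | z \in <[y]>%VS]| +
     (#|A| + #|[set x in singular | polar x y != 0%R]|))%N.
    rewrite -!sum1_card (bigID (fun z => z \in <[y]>%VS)) /=; congr (_ + _)%N.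
      by apply: eq_bigl => z; rewrite [RHS]in_set.
    rewrite (bigID (fun z => polar y z == 0)) /=; congr (_ + _)%N.
      by apply: eq_bigl => z; rewrite [RHS]in_set -andbA [(_ \notin _) && _]andbC.
    apply: eq_bigl => z; rewrite [RHS]in_set polar_sym // -andbA; congr (_ && _).
    by apply: andb_idl; apply: contra => zy; rewrite polar_sym // (polar_vline yS zy).
  rewrite card_singular c1 c2; move: #|A| => a.
  have [k qk] : exists k, q = k.+1 by exists q.-1; rewrite prednK.
  have mS x : (x * q - x = x * k)%N by rewrite qk mulnS addKn.
  have -> : (q ^ 5 - q ^ 4 = q ^ 4 * k)%N by rewrite -mS -expnSr.
  have -> : (q ^ 2 - q = q * k)%N by rewrite -mS mulnn.
  have -> : (q ^ 2 - 1 = k * (q + 1))%N.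
    by rewrite -[X in (_ - X)%N](exp1n 2) subn_sqr qk subn1.
  rewrite qk subn1 /= => E; apply: (@addnI (k + k.+1 ^ 4 * k)%N).
  transitivity (k + (a + k.+1 ^ 4 * k))%N; first by ring.
  by rewrite -E; ring.
have : #|A| = (#|[set l in lines | y \in l]| * (q ^ 2 - q))%N.
  rewrite -sum_nat_const.
  transitivity (\sum_(l in [set l in lines | y \in l])
      \sum_(z in singular | z \notin <[y]>%VS) (z \in l : nat)).
    rewrite exchange_big /= -sum1_card.
    rewrite (eq_bigl (fun z => ((z \in singular) && (z \notin <[y]>%VS)) && (polar y z == 0))); last first.
      by move=> z; rewrite [LHS]in_set -andbA [(_ \notin _) && _]andbC.
    rewrite big_mkcondr /=; apply: eq_bigr => z /andP[zS zy].
    have -> : (if polar y z == 0 then 1%N else 0%N) = (polar y z == 0) by case: ifP.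
    rewrite -(card_lines_through_pair yS zS zy) -sum1_card.
    rewrite (eq_bigl (fun l => (l \in [set l in lines | y \in l]) && (z \in l))) => [|l].
      by rewrite big_mkcondr; apply: eq_bigr => l _; case: (z \in l).
    apply/setIdP/andP => [[ll /andP[yl zl]]|[/setIdP[ll yl] zl]].
      by split=> //; apply/setIdP.
    by rewrite yl.
  apply: eq_bigr => l /setIdP[ll yl]; rewrite -(card_line_minus_point ll yl y0).
  rewrite -sum1_card -big_mkcondr /=; apply: eq_bigl => z.
  apply/andP/setIdP => [[/andP[zS zy] zl]|[zl zy]] //; split=> //; rewrite zy andbT.
  apply: line_singular ll zl _; by apply: contraNneq zy => ->; apply: mem0v.
rewrite cA => /eqP; rewrite eqn_pmul2r => [/eqP //|].
by rewrite subn_gt0 -{1}[q]expn1 ltn_exp2l // (ltn_trans _ q2).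
Qed.

Section VanishingSums.
Variable h : K -> int.
Hypothesis h_scale : forall t x, t \in Fq -> t != 0 -> h (t * x) = h x.
Hypothesis h_sqr : forall x, x \in singular -> h x * h x = 1.
Hypothesis h_corr : \sum_(x in singular) \sum_(y in singular | polar x y == 0) h x * h y
  = - (q ^ 2 * (q - 1) * #|singular|)%N%:R.

(** The sum over the lines of the squares of the sums vanishes: a pair (x, y) is counted
    once if x and y are orthogonal, and q^2 times more if they are proportional;
    the hypothesis on h is what balances the two contributions. *)
Lemma line_sum0 l : l \in lines -> \sum_(x in singular | x \in l) h x = 0.
Proof.
pose s (l : {vspace K}) := \sum_(x in singular | x \in l) h x.
suff : \sum_(l in lines) s l ^+ 2 = 0.
  move/eqP; rewrite Num.Theory.psumr_eq0 => [/allP all0 ll|l' _]; last exact: Num.Theory.sqr_ge0.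
  by have := all0 l (mem_index_enum _); rewrite ll /= sqrf_eq0 => /eqP.
transitivity (\sum_(x in singular) \sum_(y in singular) h x * h y *
   (#|[set l in lines | (x \in l) && (y \in l)]|%:R)).
  transitivity (\sum_(l in lines) \sum_(x in singular) \sum_(y in singular)
     h x * h y * ((x \in l) && (y \in l))%:R).
    apply: eq_bigr => l' _; rewrite expr2 /s big_distrl /= big_mkcondr.
    apply: eq_bigr => x _; rewrite big_distrr /= big_mkcondr.
    case: (x \in l'); first by apply: eq_bigr => y _; case: (y \in l'); rewrite ?mulr1 ?mulr0.
    by rewrite big1 // => y _; rewrite mulr0.
  rewrite exchange_big; apply: eq_bigr => x _; rewrite exchange_big; apply: eq_bigr => y _ /=.
  rewrite -mulr_sumr -sum1_card natr_sum; congr (_ * _).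
  rewrite big_mkcond [RHS]big_mkcond /=; apply: eq_bigr => l' _.
  by rewrite [_ \in [set _ in _ | _]]in_set; case: (l' \in lines) => //=; case: (_ && _).
transitivity (\sum_(x in singular)
  (\sum_(y in singular | polar x y == 0) h x * h y + (q ^ 2 * (q - 1))%N%:R)).
  apply: eq_bigr => x xS.
  have -> : (q ^ 2 * (q - 1))%N%:R = \sum_(y in singular | y \in <[x]>%VS) h x * h y * (q ^ 2)%N%:R.
    rewrite (eq_bigr (fun=> (q ^ 2)%N%:R)) => [|y /andP[yS yx]].
      rewrite natrM -[(q - 1)%N](card_singular_vline xS) mulr_natr -sumr_const.
      by apply: eq_bigl => y; rewrite [LHS]in_set.
    have [t tF e] := mem_vline_Fq _ _ yx.
    have t0 : t != 0 by case/singularP: yS => + _; rewrite e mulf_eq0 negb_or => /andP[].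
    by rewrite e h_scale // h_sqr // mul1r.
  rewrite !big_mkcondr -big_split /=; apply: eq_bigr => y yS.
  have [yx|yx] := boolP (y \in <[x]>%VS).
    rewrite (polar_vline xS yx) eqxx.
    have -> : [set l in lines | (x \in l) && (y \in l)] = [set l in lines | x \in l].
      apply/setP=> l'; apply/setIdP/setIdP => [[ll /andP[]]//|[ll xl]]; split=> //.
      by rewrite xl; apply: (subvP _ _ yx); rewrite -memvE.
    by rewrite (card_lines_through xS) natrD mulrDr mulr1 addrC.
  rewrite (card_lines_through_pair xS yS yx) addr0.
  by case: ifP; rewrite ?mulr1 ?mulr0.
rewrite big_split /= h_corr sumr_const -[X in _ + X]mulr_natr -natrM.
by rewrite addNr.
Qed.

End VanishingSums.

(** A set with vanishing signed sums contains half of the q^2 - 1 nonzero vectors of each line,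
    hence half of its points. *)
Lemma half_ovoid (D : {set K}) : D \subset singular ->
  (forall t x, t \in Fq -> t != 0 -> (t * x \in D) = (x \in D)) ->
  (let h x : int := if x \in D then 1 else -1 in
   \sum_(x in singular) \sum_(y in singular | polar x y == 0) h x * h y
     = - (q ^ 2 * (q - 1) * #|singular|)%N%:R) ->
  is_m_ovoid q ((q + 1) %/ 2) (point_set D).
Proof.
move=> /subsetP DS DZ hsum.
have q2 := q_gt2 q_mod4.
split.
  apply/subsetP=> P /imsetP[x xD ->]; have [x0 Qx] := singularP _ _ (DS x xD).
  rewrite inE dim_vline x0 /=; apply/forallP=> y; apply/implyP=> yx.
  by have [t tF ->] := mem_vline_Fq _ _ yx; rewrite quadric_formZ // Qx mulr0.
move=> l ll; pose h x : int := if x \in D then 1 else -1.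
have h0 : \sum_(x in singular | x \in l) h x = 0.
  apply: (line_sum0 _ _ hsum ll); last by move=> x _; rewrite /h; case: ifP.
  by move=> t x tF t0; rewrite /h DZ.
have cl : #|[set x in singular | x \in l]| = (q ^ 2 - 1)%N.
  have [d s] := linesP _ ll; have := cardsD1 0 [set x | x \in l].
  rewrite inE mem0v cardsE card_vspace card_F d add1n => ->.
  rewrite subn1 /=; apply: eq_card => x.
  apply/setIdP/setD1P => [[/singularP[x0 _] xl]|[x0]]; first by rewrite inE.
  by rewrite inE => xl; split=> //; apply: line_singular ll xl x0.
have cD : (2 * #|[set x in D | x \in l]| = q ^ 2 - 1)%N.
  rewrite -cl; apply/eqP; rewrite -(Num.Theory.eqr_nat int) natrM -!sumr_const /=.
  rewrite -subr_eq0 -[X in _ == X]h0 mulr_sumr.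
  rewrite [X in X - _](_ : _ = \sum_(x in singular | x \in l) (if x \in D then 2%:R else 0)).
    rewrite [X in _ - X](_ : _ = \sum_(x in singular | x \in l) 1); last first.
      by apply: eq_bigl => x; rewrite [LHS]in_set.
    rewrite -sumrB; apply/eqP/eq_bigr => x _; rewrite /h; by case: ifP.
  rewrite -big_mkcondr /=; apply: eq_big => [x|x _]; last by rewrite mulr1.
  rewrite [LHS]in_set [RHS]andbC; have [xD|//] := boolP (x \in D).
  by rewrite (DS x xD).
have cP : #|[set x in D | x \in l]| = (#|[set P in point_set D | (P <= l)%VS]| * (q - 1))%N.
  rewrite -sum_nat_const -sum1_card.
  rewrite (partition_big (fun x => <[x]>%VS) (mem [set P in point_set D | (P <= l)%VS])) /=.
    apply: eq_bigr => P /setIdP[/imsetP[x xD ->] xl].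
    rewrite -(card_singular_vline (DS x xD)) -sum1_card; apply: eq_bigl => y.
    have [x0 _] := singularP _ _ (DS x xD).
    apply/andP/setIdP => [[/setIdP[yD yl] /eqP yx]|[yS yx]].
      by rewrite DS // memvE yx.
    have [y0 _] := singularP _ _ yS.
    have [t tF e] := mem_vline_Fq _ _ yx.
    have t0 : t != 0 by move: y0; rewrite e mulf_eq0 negb_or => /andP[].
    split; first by apply/setIdP; rewrite e DZ // -e xD; split=> //; apply: (subvP xl).
    by rewrite eqEdim !dim_vline x0 y0 -memvE yx.
  move=> x /setIdP[xD xl]; apply/setIdP; rewrite -memvE; split=> //.
  by apply: imset_f.
move: cD; rewrite cP; have -> : (q ^ 2 - 1 = (q - 1) * (q + 1))%N.
  by rewrite -[X in (_ - X)%N](exp1n 2) subn_sqr.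
rewrite mulnA mulnC => /eqP; rewrite eqn_pmul2l ?subn_gt0 ?(ltn_trans _ q2) //.
by move/eqP <-; rewrite mulKn.
Qed.

End Lines.

(** * The set D in conic coordinates *)

Section Construction.
Variables (q : nat) (F : finFieldType) (L : fieldExtType F).
Hypothesis card_F : #|F| = q.
Hypothesis q_mod4 : (q = 3 %[mod 4])%N.
Hypothesis dim_L : (\dim {:L} = 6)%N.
Local Notation K := (finvect_type L).
Variables (w g : K).
Hypothesis prim_w : (q ^ 3 - 1)%N.-primitive_root w.
Hypothesis prim_g : (q ^ 6 - 1)%N.-primitive_root g.
Hypothesis norm_g : g ^+ (q ^ 3 + 1) = w.
Variable d : 'I_q.+1 -> 'I_(NN q).
Hypothesis inj_d : injective d.
Hypothesis im_d : [set d i | i : 'I_q.+1] = I_Q q w.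
Variable C0 : {group {unit K}}.
Hypothesis index_C0 : (#|[set: {unit K}] : C0|%g = 4 * NN q)%N.

Local Notation N := (NN q).
Local Notation E := (fixF K q 3).
Local Notation Fq := (fixF K q 1).
Local Notation bar x := (x ^+ (q ^ 3)).
Local Notation nm x := (x ^+ (q ^ 3 + 1)).
Local Notation Tr3 x := (trace q 3 x).
Local Notation Tr6 x := (trace q 6 x).
Local Notation normFq := (normFq K q).
Local Notation singular := (@singular q F L).
Local Notation polar := (@polar q F L).

Let frobD := @frobenius_additive q F L card_F.
Let card_K := card_sextic card_F dim_L.
Let q2 := q_gt2 q_mod4.
Let q0 : (0 < q)%N := ltn_trans (isT : (0 < 2)%N) q2.

Lemma NN_gt1 : (1 < N)%N.
Proof. by rewrite /NN -mulnn; nia. Qed.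

Lemma NN_mod4 : (N = 1 %[mod 4])%N.
Proof.
have [k ->] := q_decomp q_mod4; rewrite /NN.
have -> : ((4 * k + 3) ^ 2 + (4 * k + 3) + 1 = (4 * k ^ 2 + 7 * k + 3) * 4 + 1)%N by ring.
by rewrite modnMDl.
Qed.

Lemma coprime_4_NN : coprime 4 N.
Proof. by rewrite -[4%N]/(2 ^ 2)%N coprimeXl // coprime2n odd_NN. Qed.

Lemma q3_mod_NN : (q ^ 3 = 1 %[mod N])%N.
Proof.
have -> : (q ^ 3 = (q - 1) * N + 1)%N.
  by rewrite -(q3_norm q_mod4) subnK // expqn_gt0.
by rewrite modnMDl.
Qed.

Lemma coprime_q_NN : coprime q N.
Proof.
have -> : N = (q.+1 * q + 1)%N by rewrite /NN; ring.
by rewrite /coprime gcdnMDl gcdn1.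
Qed.

Lemma w_E : w \in E.
Proof. by rewrite -norm_g; apply: nm_E card_K _. Qed.

Lemma w_neq0 : w != 0.
Proof. by rewrite -norm_g expf_neq0 // (gen_neq0 prim_g). Qed.

Lemma FqE x : x != 0 -> (x \in Fq) = (x ^+ (q - 1) == 1).
Proof.
by move=> x0; rewrite inE expn1 -{1}(prednK q0) exprS -subn1 mulr_eq_self.
Qed.

(** The group E^* / F_q^* is cyclic of order N, generated by the image of w. *)
Lemma w_ratio_Fq m n : (w ^+ m / w ^+ n \in Fq) = (m == n %[mod N])%N.
Proof.
have w0 := w_neq0; have e0 k : w ^+ k != 0 by rewrite expf_neq0.
rewrite FqE ?mulf_neq0 ?invr_eq0 // exprMn exprVn -(inj_eq (mulIf (expf_neq0 (q - 1) (e0 n)))).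
rewrite divfK ?expf_neq0 // mul1r -!exprM (eq_prim_root_expr prim_w) (q3_norm q_mod4).
by rewrite ![(_ * (q - 1))%N]mulnC -!muln_modr eqn_pmul2l // subn_gt0 (ltn_trans _ q2).
Qed.

(** A Frobenius conjugate of the conic point w^(d i).  Conjugating by q^2 compensates the factor
    - (q + 1) = q^2 mod N in the exponents that define D. *)
Definition conic_pt (i : 'I_q.+1) : K := w ^+ (d i * q ^ 2).

Lemma conic_pt_frob i : conic_pt i = (w ^+ d i) ^+ (q ^ 2).
Proof. by rewrite -exprM. Qed.

Lemma conic_pt_E i : conic_pt i \in E. Proof. by rewrite /conic_pt fixFX ?w_E. Qed.

Lemma conic_pt_neq0 i : conic_pt i != 0. Proof. by rewrite expf_neq0 ?w_neq0. Qed.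

Lemma trace_conic_pt i j : Tr3 (conic_pt i * conic_pt j) = Tr3 (w ^+ (d i + d j)).
Proof. by rewrite !conic_pt_frob -exprMn -exprD trace_frobn // fixFX ?w_E. Qed.

Lemma conic_pt_conic i : Tr3 (conic_pt i * conic_pt i) = 0.
Proof.
rewrite trace_conic_pt addnn -mul2n; have : d i \in I_Q q w by rewrite -im_d imset_f.
by rewrite inE => /eqP.
Qed.

(** Put r = y / x.  The three traces are linear equations in the conjugates of x^2 with
    a Vandermonde matrix in the conjugates of r; as x is nonzero, two
    of these conjugates coincide, which forces r to be in F_q. *)
Lemma isotropic_pair x y : x \in E -> y \in E -> x != 0 ->
  Tr3 (x * x) = 0 -> Tr3 (x * y) = 0 -> Tr3 (y * y) = 0 -> y / x \in Fq.
Proof.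
move=> xE yE x0; have [r rE ->] : exists2 r, r \in E & y = r * x.
  by exists (y / x); rewrite ?fixF_div // divfK.
rewrite mulfK // mulrCA [r * x * _]mulrACA !trace3E !exprMn => t0 t1 t2.
(* Multiply by the polynomial that vanishes at the other two conjugates of r. *)
have : (x * x) * (r - r ^+ q) * (r - r ^+ (q ^ 2)) = 0.
  transitivity ((r * r * (x * x) + r ^+ q * r ^+ q * (x ^+ q * x ^+ q)
      + r ^+ (q ^ 2) * r ^+ (q ^ 2) * (x ^+ (q ^ 2) * x ^+ (q ^ 2)))
    - (r ^+ q + r ^+ (q ^ 2)) *
      (r * (x * x) + r ^+ q * (x ^+ q * x ^+ q) + r ^+ (q ^ 2) * (x ^+ (q ^ 2) * x ^+ (q ^ 2)))
    + r ^+ q * r ^+ (q ^ 2) * (x * x + x ^+ q * x ^+ q + x ^+ (q ^ 2) * x ^+ (q ^ 2))); first by ring.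
  by rewrite t0 t1 t2; ring.
move/eqP; rewrite !mulf_eq0 !(negbTE x0) /= !subr_eq0 => /orP[] /eqP rq.
  by apply/fixFP; rewrite expn1 -rq.
apply/fixFP; rewrite expn1 {1}rq -exprM -expnSr.
exact/fixFP.
Qed.

Lemma d_mod_inj i j : (d i == d j %[mod N])%N -> i = j.
Proof. by rewrite !modn_small // => /eqP/val_inj/inj_d. Qed.

Lemma conic_pt_sep i j : i != j -> Tr3 (conic_pt i * conic_pt j) != 0.
Proof.
apply: contraNneq => tij; apply/eqP/d_mod_inj.
rewrite -(eqn_modMl _ _ (coprimeXl 2 coprime_q_NN)) ![(q ^ 2 * _)%N]mulnC eq_sym -w_ratio_Fq.
exact: isotropic_pair
  (conic_pt_E i) (conic_pt_E j) (conic_pt_neq0 i) (conic_pt_conic i) tij (conic_pt_conic j).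
Qed.

Lemma conic_pt_sqr_inj i j : conic_pt i ^+ 2 / conic_pt j ^+ 2 \in Fq -> i = j.
Proof.
rewrite -!exprM w_ratio_Fq -!mulnA ![(d _ * _)%N]mulnC.
by rewrite eqn_modMl ?coprimeMl ?coprimeXl ?coprime_q_NN ?coprime2n ?odd_NN //; apply: d_mod_inj.
Qed.

(** Squaring is a bijection from the conic to the points of the line Tr(y) = 0, because N is
    odd. *)
Lemma conic_param y : y \in E -> y != 0 -> Tr3 y = 0 ->
  exists i, y / conic_pt i ^+ 2 \in Fq.
Proof.
move=> yE y0 ty; have [e ye] : exists e, y = w ^+ e.
  have y1 : y ^+ (q ^ 3 - 1) = 1.
    by rewrite (q3_halfE q_mod4) addnK (E_expr q_mod4).
  by have [i ->] := prim_rootP prim_w y1; exists i.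
(* The inverse of 2 is (N + 1) / 2 and that of q^2 is q, modulo N. *)
pose m := ((e * q * uphalf N) %% N)%N.
have mN : (m < N)%N by rewrite ltn_mod (ltn_trans _ NN_gt1).
have e2 : (e == 2 * m * q ^ 2 %[mod N])%N.
  apply/eqP/esym.
  rewrite /m -modnMml modnMmr modnMml.
  have -> : (2 * (e * q * uphalf N) * q ^ 2 = e * (2 * uphalf N) * q ^ 3)%N by ring.
  rewrite -modnMmr q3_mod_NN modnMmr muln1 mul2n uphalfK odd_NN // -modnMmr modnDr.
  by rewrite modnMmr muln1.
have yF : y / (w ^+ (2 * m)) ^+ (q ^ 2) \in Fq by rewrite -exprM ye w_ratio_Fq.
have wm0 : (w ^+ (2 * m)) ^+ (q ^ 2) != 0 by rewrite !expf_neq0 ?w_neq0.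
have mI : Ordinal mN \in I_Q q w.
  rewrite inE /= -(trace_frobn 2) ?fixFX ?w_E //.
  have c0 : y / (w ^+ (2 * m)) ^+ (q ^ 2) != 0 by rewrite mulf_neq0 ?invr_eq0.
  have := ty; rewrite -[y](divfK wm0) traceZ // => /eqP.
  by rewrite mulf_eq0 (negbTE c0).
move: mI; rewrite -im_d => /imsetP[i _ mi]; exists i.
have -> // : conic_pt i ^+ 2 = (w ^+ (2 * m)) ^+ (q ^ 2).
by rewrite conic_pt_frob -mi /= -!exprM; congr (w ^+ _); ring.
Qed.

(** Conic coordinates (i, u) on the nonzero singular vectors. *)
Definition quadric_vec (p : 'I_q.+1 * K) : K := conic_pt p.1 * p.2.

Lemma quadric_vec_singular i u : u \in normFq -> conic_pt i * u \in singular.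
Proof.
move=> /normFqP[u0 uF]; apply/singularP; split; first by rewrite mulf_neq0 ?conic_pt_neq0.
rewrite /quadric_form exprMn mulrC traceZ // (nm_bar _ (conic_pt i)).
by rewrite (fixFP _ _ _ (conic_pt_E i)) conic_pt_conic mulr0.
Qed.

Lemma nm_conic_pt i : nm (conic_pt i) = conic_pt i ^+ 2.
Proof. by rewrite nm_bar (fixFP _ _ _ (conic_pt_E i)). Qed.

Lemma singular_quadric_vec x : x \in singular -> exists i, x / conic_pt i \in normFq.
Proof.
move=> /singularP[x0 Qx]; have nx : nm x != 0 by rewrite expf_neq0.
have [i iF] := conic_param (nm_E card_K x) nx Qx.
exists i; apply/normFqP; rewrite mulf_neq0 ?invr_eq0 ?conic_pt_neq0 //; split=> //.
by rewrite exprMn exprVn nm_conic_pt.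
Qed.

Lemma quadric_vec_inj : {in setX setT normFq &, injective quadric_vec}.
Proof.
move=> [i u] [j v] /setXP[_ /= uV] /setXP[_ /= vV]; rewrite /quadric_vec /= => e.
have ij : i = j.
  apply: conic_pt_sqr_inj; case/normFqP: uV => u0 uF; case/normFqP: vV => v0 vF.
  have : nm (conic_pt i * u) = nm (conic_pt j * v) by rewrite e.
  rewrite !exprMn !nm_conic_pt => e2.
  have -> : conic_pt i ^+ 2 / conic_pt j ^+ 2 = nm v / nm u.
    apply: (mulIf (expf_neq0 (q ^ 3 + 1) u0)); rewrite divfK ?expf_neq0 // mulrAC e2.
    by rewrite mulrAC mulfV ?mul1r // expf_neq0 ?conic_pt_neq0.
  exact: fixF_div.
by rewrite ij in e *; rewrite (mulfI (conic_pt_neq0 j) e).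
Qed.

Lemma singular_image : singular = quadric_vec @: setX setT normFq.
Proof.
apply/setP=> x; apply/idP/imsetP => [xS|[[i u] /setXP[_ /= uV] ->]]; last exact: quadric_vec_singular.
have [i iV] := singular_quadric_vec xS; exists (i, x / conic_pt i); first by apply/setXP.
by rewrite /quadric_vec /= mulrC divfK ?conic_pt_neq0.
Qed.

Lemma sum_singular (P : pred K) (G : K -> int) :
  \sum_(x in singular | P x) G x = \sum_i \sum_(u in normFq | P (conic_pt i * u)) G (conic_pt i * u).
Proof.
rewrite singular_image big_mkcondr (big_imset _ quadric_vec_inj) /=.
rewrite [RHS](eq_bigr (fun i => \sum_(u in normFq) if P (conic_pt i * u) then G (conic_pt i * u) else 0)).
  rewrite pair_big_dep /=; apply: eq_bigl => -[i u]; rewrite in_setX inE //.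
by move=> i _; rewrite big_mkcondr.
Qed.

Lemma card_singular : #|singular| = ((q ^ 3 + 1) * (q ^ 2 - 1))%N.
Proof.
rewrite singular_image (card_in_imset quadric_vec_inj) cardsX cardsT card_ord.
rewrite (card_normFq q_mod4 prim_g).
have -> : (q ^ 2 - 1 = (q - 1) * (q + 1))%N by rewrite -[X in (_ - X)%N](exp1n 2) subn_sqr.
by rewrite -addn1; move: (q - 1)%N (q ^ 3)%N => a b; ring.
Qed.

Lemma card_C0 : (#|C0| * (4 * N))%N = (q ^ 6 - 1)%N.
Proof.
rewrite -index_C0 (Lagrange (subsetT C0)) card_finField_unit card_K.
by rewrite subn1.
Qed.

Lemma C0_roots : [set FinRing.uval u | u in C0] = [set x : K | x ^+ #|C0| == 1].
Proof.
apply/eqP; rewrite eqEcard; apply/andP; split.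
  apply/subsetP=> x /imsetP[u uC ->].
  by rewrite inE -FinRing.val_unitX expg_cardG.
rewrite (card_unity prim_g); last by rewrite -card_C0 dvdn_mulr.
by rewrite card_imset //; apply: val_inj.
Qed.

Lemma Zp_natr_eq p m n : (1 < p)%N -> ((m%:R : 'Z_p) == n%:R) = (m == n %[mod p])%N.
Proof. by move=> p1; rewrite -val_eqE /= !val_Zp_nat. Qed.

(** The unit group is cyclic, so C0 consists of the roots of unity of order dividing
    (q^6 - 1) / 4N, and the coset of g^n is determined by n mod 4N. *)
Lemma mem_D_set n : (g ^+ n \in D_set w g d C0) = (n%:R \in I_D w d).
Proof.
have p1 : (1 < 4 * N)%N by have := NN_gt1; lia.
have c0 : (0 < #|C0|)%N by apply: cardG_gt0.
have ge0 m : g ^+ m != 0 by rewrite expf_neq0 // (gen_neq0 prim_g).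
have mem_class e : (g ^+ n \in cyclotomic_class g C0 e) = (n == e %[mod 4 * N])%N.
  have -> : (n == e %[mod 4 * N])%N = ((g ^+ n / g ^+ e) ^+ #|C0| == 1).
    have div_eq1 (x y : K) : y != 0 -> (x / y == 1) = (x == y).
      by move=> y0; rewrite -(inj_eq (mulIf y0)) divfK // mul1r.
    rewrite exprMn exprVn div_eq1 ?(expf_neq0 _ (ge0 e)) // -!exprM (eq_prim_root_expr prim_g) -card_C0.
    by rewrite ![(_ * #|C0|)%N]mulnC -!muln_modr eqn_pmul2l.
  have -> : ((g ^+ n / g ^+ e) ^+ #|C0| == 1) = (g ^+ n / g ^+ e \in [set FinRing.uval u | u in C0]).
    by rewrite C0_roots inE.
  apply/imsetP/imsetP => [[u uC e1]|[u uC e1]]; exists u => //.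
    by rewrite e1 mulrC mulKf.
  by rewrite -e1 mulrC divfK.
apply/bigcupP/idP => [[e eI]|nI]; last first.
  by exists (n%:R) => //; rewrite mem_class val_Zp_nat // modn_mod.
rewrite mem_class -(Zp_natr_eq _ _ p1) natr_Zp => /eqP -> //.
Qed.

(** Chinese remainders: 4 divides q + 1 and N = 1 mod 4, while - (q + 1) = q^2 mod N. *)
Lemma exponent_mod n i j :
  (n + (q + 1) * j == N * i %[mod 4 * N])%N =
  (n == i %[mod 4])%N && (n == q ^ 2 * j %[mod N])%N.
Proof.
rewrite chinese_remainder ?coprime_4_NN //; congr (_ && _).
  have -> : (q + 1 = (q %/ 4 + 1) * 4)%N by lia.
  by rewrite mulnAC addnC modnMDl -[in RHS](mul1n i) -[in RHS]modnMml -NN_mod4 modnMml.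
have -> : (n + (q + 1) * j == N * i %[mod N])%N =
    (n + (q + 1) * j + q ^ 2 * j == N * i + q ^ 2 * j %[mod N])%N by rewrite eqn_modDr.
have -> : (n + (q + 1) * j + q ^ 2 * j = j * N + n)%N by rewrite /NN; ring.
by rewrite [(N * i)%N]mulnC !modnMDl.
Qed.

Lemma mem_exponents n J (S : {set 'Z_N}) :
  ((n%:R : 'Z_(4 * N)) \in exponents J S) =
  has (fun i => n == i %[mod 4])%N J && [exists j in S, n == q ^ 2 * j %[mod N]]%N.
Proof.
have p1 : (1 < 4 * N)%N by have := NN_gt1; lia.
have eqE i (j : 'Z_N) : (n%:R == (N * i)%N%:R - ((q + 1) * j)%N%:R :> 'Z_(4 * N)) =
    (n == i %[mod 4])%N && (n == q ^ 2 * j %[mod N])%N.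
  by rewrite eq_sym subr_eq eq_sym -natrD Zp_natr_eq // exponent_mod.
rewrite inE; apply/exists_inP/andP => [[j jS /hasP[i iJ]]|[/hasP[i iJ ni] /exists_inP[j jS nj]]].
  rewrite eqE => /andP[ni nj]; split; first by apply/hasP; exists i.
  by apply/exists_inP; exists j.
by exists j => //; apply/hasP; exists i => //; rewrite eqE ni.
Qed.

Lemma mem_double_double (A : {set 'Z_N}) n :
  [exists j in Defs.double (Defs.double A), n == q ^ 2 * j %[mod N]]%N =
  [exists s in A, n == q ^ 2 * (4 * s) %[mod N]]%N.
Proof.
have N1 := NN_gt1.
have dE (s t : 'Z_N) : t = 2%:R * (2%:R * s) ->
    (q ^ 2 * t = q ^ 2 * (4 * s) %[mod N])%N.
  move=> ->; have -> : 2%:R * (2%:R * s) = (4 * s)%N%:R :> 'Z_N.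
    by rewrite natrM natr_Zp mulrA -natrM.
  by rewrite val_Zp_nat // modnMmr.
apply/exists_inP/exists_inP => [[j /imsetP[s1 /imsetP[s sA ->] jE]]|[s sA ns]].
  by rewrite (dE _ _ jE); exists s.
exists (2%:R * (2%:R * s)); last by rewrite (dE s).
by apply/imsetP; exists (2%:R * s) => //; apply: imset_f.
Qed.

(** The element of calX attached to the index i; its square class in E is the sign
    of the conic point i. *)
Definition calX_elt (i : 'I_q.+1) : K :=
  if i == ord0 then 2%:R * w ^+ d i else w ^+ d i * Tr3 (w ^+ (d ord0 + d i)).

Lemma calX_image : calX w d = [set calX_elt i | i : 'I_q.+1].
Proof.
apply/setP=> x; apply/setUP/imsetP => [[/imsetP[i i0 ->]|]|[i _ ->]].
- by rewrite inE in i0; exists i => //; rewrite /calX_elt (negbTE i0).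
- by rewrite inE => /eqP ->; exists ord0.
rewrite /calX_elt; case: ifP => i0; first by right; rewrite (eqP i0) inE.
by left; apply: imset_f; rewrite inE i0.
Qed.

Lemma calX_elt_ratio i : calX_elt i != 0 /\ calX_elt i / w ^+ d i \in Fq.
Proof.
have wi : w ^+ d i != 0 by rewrite expf_neq0 ?w_neq0.
rewrite /calX_elt; case: ifP => i0.
  by rewrite mulf_neq0 ?(two_neq0 q_mod4 prim_g) // mulfK // fixF_nat.
have t0 : Tr3 (conic_pt ord0 * conic_pt i) != 0 by rewrite conic_pt_sep // eq_sym i0.
rewrite [w ^+ d i * _]mulrC mulfK // -trace_conic_pt mulf_neq0 //.
by split=> //; apply: trace_fixF1 => //; apply: fixFM => //; apply: conic_pt_E.
Qed.

Lemma calX_elt_E i : calX_elt i \in E.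
Proof.
have [_ cF] := calX_elt_ratio i; have wi : w ^+ d i != 0 by rewrite expf_neq0 ?w_neq0.
by rewrite -(divfK wi (calX_elt i)) fixFM ?fixFX ?w_E //; apply: fixF1_sub.
Qed.

Lemma calX_elt_sign i : quad q (calX_elt i) = conic_sign q ord0 conic_pt i.
Proof.
rewrite -(quad_frob q_mod4 prim_g 2 (calX_elt_E i)) /conic_sign /calX_elt.
case: ifP => [/eqP->|_]; rewrite exprMn -conic_pt_frob.
  by rewrite (fixFP _ _ _ (fixF_nat _ _ 2 2)).
congr (quad q (_ * _)); rewrite trace_frob // trace_conic_pt.
by rewrite trace_frobn // fixFX ?w_E.
Qed.

Lemma quad_w k : quad q (w ^+ k) = (-1) ^+ k.
Proof.
elim: k => [|k IHk]; first by rewrite /quad oner_eq0 !expr0 expr1n eqxx.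
rewrite !exprS (quadM q_mod4 prim_g) ?fixFX ?w_E // IHk; congr (_ * _).
rewrite /quad (negbTE w_neq0) -(prim_order_dvd prim_w) (q3_halfE q_mod4) addnK.
case: ifP => // /dvdn_leq.
have : (0 < halfE q)%N by have := odd_halfE q_mod4; case: (halfE q).
by move: (halfE q); clear=> e e0 /(_ e0); lia.
Qed.

(** Modulo N the logarithm of the i-th element of calX is d i, so the elements of calX have
    distinct logarithms modulo N; the parity of the logarithm is the quadratic character. *)
Lemma mem_logX i m : (m == d i %[mod N])%N ->
  (m%:R \in logX w d) = (conic_sign q ord0 conic_pt i == (-1) ^+ m).
Proof.
move=> mi; have N1 := NN_gt1; have p1 : (1 < 2 * N)%N by lia.
have c2 : coprime 2 N by rewrite coprime2n odd_NN.
have sgn (a b : nat) : ((-1 : int) ^+ a == (-1) ^+ b) = (a == b %[mod 2])%N.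
  by rewrite -(signr_odd _ a) -(signr_odd _ b) !modn2; case: (odd a); case: (odd b).
rewrite -calX_elt_sign; apply/imsetP/idP => [[k]|/eqP qe].
  rewrite inE calX_image => /imsetP[j _ wk] /eqP.
  rewrite Zp_natr_eq // chinese_remainder // => /andP[m2 mN].
  have /eqP-> : i == j; last by rewrite -wk quad_w sgn eq_sym.
  apply/eqP/d_mod_inj; rewrite -(eqP mi) (eqP mN) -w_ratio_Fq wk.
  by case: (calX_elt_ratio j).
have [e0 eF] := calX_elt_ratio i.
have e1' : calX_elt i ^+ (q ^ 3 - 1) = 1.
  by rewrite (q3_halfE q_mod4) addnK (E_expr q_mod4) // calX_elt_E.
have [k ek] := prim_rootP prim_w e1'.
exists k; first by rewrite inE calX_image -ek imset_f.
apply/eqP; rewrite Zp_natr_eq // chinese_remainder //; apply/andP; split.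
  by rewrite -sgn -qe ek quad_w.
by rewrite (eqP mi) eq_sym -w_ratio_Fq -ek.
Qed.

(** Modulo N the exponent of z u determines i; modulo 4 it is that of u, because z is
    a fourth power.  Whether i is listed in S1 or in S2 is the parity of a
    logarithm, that is, the sign of the conic point. *)
Lemma mem_D_quadric_vec i u : u \in normFq ->
  (conic_pt i * u \in D_set w g d C0) = (conic_sign q ord0 conic_pt i * sigma q g u == 1).
Proof.
move=> uV; have [u0 uF] := normFqP _ _ uV.
have N1 := NN_gt1.
have [n ge] := gen_powP q_mod4 card_K prim_g (mulf_neq0 (conic_pt_neq0 i) u0).
have nN : (n == q ^ 2 * (2 * d i) %[mod N])%N.
  have -> : (q ^ 2 * (2 * d i) = d i * q ^ 2 * 2)%N by ring.
  have zz : conic_pt i ^+ 2 = w ^+ (d i * q ^ 2 * 2) by rewrite -exprM.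
  rewrite -w_ratio_Fq -zz -{1}norm_g exprAC -ge exprMn nm_conic_pt.
  by rewrite [conic_pt i ^+ 2 * _]mulrC mulfK // expf_neq0 // conic_pt_neq0.
have cq4 : coprime (q ^ 2 * 2) N.
  by rewrite coprimeMl coprimeXl ?coprime_q_NN // coprime2n odd_NN.
have nE (s : 'Z_N) : (n == q ^ 2 * (4 * s) %[mod N])%N = (2 * s == d i %[mod N])%N.
  rewrite (eqP nN) [LHS]eq_sym -[RHS](eqn_modMl _ _ cq4).
  by congr (_ %% _ == _ %% _)%N; ring.
have qu : quart q u = imag q g ^+ n.
  rewrite -quartX -ge quartM (quart_E q_mod4 (conic_pt_E i)) ?mul1r ?conic_pt_neq0 //.
have cs : conic_sign q ord0 conic_pt i = 1 \/ conic_sign q ord0 conic_pt i = -1.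
  rewrite -calX_elt_sign; have [e0 _] := calX_elt_ratio i.
  by case: (quad_sign q_mod4 prim_g (calX_elt_E i) e0) => -[_ ->]; [left|right].
have part J (A : {set 'Z_N}) b : (forall s : 'Z_N, (2 * s == d i %[mod N])%N -> (s \in A) = b) ->
    [exists s in A, n == q ^ 2 * (4 * s) %[mod N]]%N && has (fun i => n == i %[mod 4])%N J =
    b && has (fun i => n == i %[mod 4])%N J.
  move=> Ab; congr (_ && _); apply/exists_inP/idP => [[s sA]|bT].
    by rewrite nE => /Ab <-.
  (* The solution of 2 s = d i modulo the odd number N. *)
  pose s : 'Z_N := (d i * uphalf N)%:R.
  have s2 : (2 * s == d i %[mod N])%N.
    rewrite /s val_Zp_nat // modnMmr mulnCA mul2n uphalfK odd_NN // -modnMmr modnDr.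
    by rewrite modnMmr muln1.
  by exists s; rewrite ?(Ab s s2) // nE.
rewrite ge mem_D_set in_setU !mem_exponents !mem_double_double ![has _ _ && _]andbC.
rewrite (part _ _ (conic_sign q ord0 conic_pt i == 1)); last first.
  move=> s s2; rewrite inE (mem_logX (i := i)) //.
  by rewrite exprM sqrrN !expr1n.
rewrite (part _ _ (conic_sign q ord0 conic_pt i == -1)); last first.
  move=> s s2; rewrite inE (mem_logX (i := i)) ?modnDr //.
  by rewrite exprD exprM sqrrN !expr1n mul1r -signr_odd odd_NN.
rewrite /sigma qu /= !orbF.
have [i1 i2 i3 i4 i5] := imag_neq q_mod4 card_K prim_g.
have ii := imag_sqr q_mod4 card_K prim_g.
have m1 := negbTE (opp1_neq1 q_mod4 prim_g).
have -> : imag q g ^+ n = imag q g ^+ (n %% 4).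
  have ii4 : imag q g ^+ 4 = 1 by rewrite -[4%N]/(2 * 2)%N exprM ii sqrrN expr1n.
  by rewrite {1}(divn_eq n 4) exprD mulnC exprM ii4 expr1n mul1r.
have : (n %% 4 < 4)%N by rewrite ltn_mod.
have m2 : -1 == - imag q g = false by rewrite eqr_opp eq_sym.
case: cs => ->; case: (n %% _)%N => [|[|[|[|]]]] // _;
  by rewrite ?expr0 ?expr1 ?ii ?[_ ^+ 3]exprS ?ii ?mulrN1 ?(eqxx, i1, i3, i5, m1, m2) ?(eqxx, i5) //.
Qed.

Lemma calX_log m : (m%:R \in logX w d) -> exists i, (m == d i %[mod N])%N.
Proof.
have N1 := NN_gt1; have p1 : (1 < 2 * N)%N by lia.
case/imsetP=> k; rewrite inE calX_image => /imsetP[i _ wk] /eqP.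
rewrite Zp_natr_eq // chinese_remainder ?coprime2n ?odd_NN // => /andP[_ /eqP mk].
by exists i; rewrite mk -w_ratio_Fq wk; case: (calX_elt_ratio i).
Qed.

Lemma D_sub_singular : D_set w g d C0 \subset singular.
Proof.
have N1 := NN_gt1.
apply/subsetP=> x xD.
have x0 : x != 0.
  case/bigcupP: xD => e _ /imsetP[u _ ->].
  by rewrite mulf_neq0 ?expf_neq0 ?(gen_neq0 prim_g) // -unitfE (valP u).
have [n xn] := gen_powP q_mod4 card_K prim_g x0.
have [s [i si] ns] : exists2 s, (exists i, (2 * s == d i %[mod N])%N) &
    (n == q ^ 2 * (4 * s) %[mod N])%N.
  move: xD; rewrite xn mem_D_set in_setU !mem_exponents !mem_double_double.
  case/orP=> /andP[_ /exists_inP[s]]; rewrite inE => /calX_log sX ns; exists s => //.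
  by case: sX => i; rewrite modnDr; exists i.
have iF : nm x / conic_pt i ^+ 2 \in Fq.
  have zz : conic_pt i ^+ 2 = w ^+ (d i * q ^ 2 * 2) by rewrite -exprM.
  rewrite zz xn exprAC norm_g w_ratio_Fq (eqP ns).
  have -> : (q ^ 2 * (4 * s) = q ^ 2 * 2 * (2 * s))%N by ring.
  by rewrite -modnMmr (eqP si) modnMmr; apply/eqP; congr (_ %% _)%N; ring.
rewrite -(divfK (conic_pt_neq0 i) x) mulrC; apply: quadric_vec_singular; apply/normFqP.
by rewrite mulf_neq0 ?invr_eq0 ?conic_pt_neq0 // exprMn exprVn nm_conic_pt.
Qed.

Lemma D_scale t x : t \in Fq -> t != 0 ->
  (t * x \in D_set w g d C0) = (x \in D_set w g d C0).
Proof.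
move=> tF t0; have /subsetP DS := D_sub_singular.
have [xS|xS] := boolP (x \in singular); last first.
  rewrite (contraNF (DS x) xS); apply: contraNF xS => /DS.
  by rewrite singularZ.
have [i iV] := singular_quadric_vec xS.
have -> : x = conic_pt i * (x / conic_pt i) by rewrite mulrC divfK ?conic_pt_neq0.
have tV : t * (x / conic_pt i) \in normFq by rewrite normFqM // Fq_normFq.
rewrite mulrCA !mem_D_quadric_vec // /sigma quartM (quart_Fq q_mod4) // mul1r //.
Qed.

Lemma D_sign i u : u \in normFq ->
  (if conic_pt i * u \in D_set w g d C0 then 1 else -1) = conic_sign q ord0 conic_pt i * sigma q g u.
Proof.
move=> uV; rewrite mem_D_quadric_vec //.
have : conic_sign q ord0 conic_pt i = 1 \/ conic_sign q ord0 conic_pt i = -1.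
  rewrite -calX_elt_sign; have [e0 _] := calX_elt_ratio i.
  by case: (quad_sign q_mod4 prim_g (calX_elt_E i) e0) => -[_ ->]; [left|right].
by case=> ->; rewrite /sigma; case: (_ || _).
Qed.

Lemma D_ovoid : is_m_ovoid q ((q + 1) %/ 2) (point_set (D_set w g d C0)).
Proof.
apply: (half_ovoid card_F q_mod4 dim_L prim_g card_singular D_sub_singular D_scale).
rewrite card_singular /=.
rewrite -(correlation_sum q_mod4 frobD card_K prim_g ord0
  conic_pt_E conic_pt_neq0 conic_pt_conic conic_pt_sep (card_ord _)).
rewrite (eq_bigl (fun x => (x \in singular) && predT x)) => [|x]; last by rewrite andbT.
rewrite sum_singular; apply: eq_bigr => i _.
rewrite [RHS]exchange_big /=; apply: eq_big => [u|u]; rewrite andbT // => uV.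
rewrite sum_singular; apply: eq_bigr => j _; apply: eq_bigr => v /andP[vV _].
by rewrite !D_sign.
Qed.

End Construction.

Theorem theorem4p2
  (q : nat) (F : finFieldType) (L : fieldExtType F)
  (card_F : #|F| = q) (q_mod4 : (q = 3 %[mod 4])%N)
  (dim_L : (\dim {:L} = 6)%N)
  (w g : finvect_type L)
  (prim_w : (q ^ 3 - 1)%N.-primitive_root w)
  (prim_g : (q ^ 6 - 1)%N.-primitive_root g)
  (norm_g : g ^+ (q ^ 3 + 1) = w)
  (d : 'I_q.+1 -> 'I_(NN q))
  (inj_d : injective d)
  (im_d : [set d i | i : 'I_q.+1] = I_Q q w)
  (C0 : {group {unit (finvect_type L)}})
  (index_C0 : (#|[set: {unit (finvect_type L)}] : C0|%g = 4 * NN q)%N) :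
  is_m_ovoid q ((q + 1) %/ 2) (point_set (D_set w g d C0)).
Proof.
exact: (D_ovoid card_F q_mod4 dim_L prim_w prim_g norm_g inj_d im_d index_C0).
Qed.
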